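(* For a simple graph $G$ the following are equivalent: (1) $G$ is $(2,1)$-tight; (2) $G$ can be derived from $K_5\setminus e$ or from $K_4\sqcup K_4$ by a finite sequence of Henneberg 1, Henneberg 2, vertex-to-$K_4$, edge joining and edge-to-$K_3$ moves; (3) $G$ is the edge-disjoint union of a spanning tree $T$ and a spanning subgraph $P$ in which every connected component contains exactly one cycle.
   Context: For a graph $H$ let $f(H)=2|V(H)|-|E(H)|$. For $\ell\in\{1,2,3\}$, a simple graph $G$ is $(2,\ell)$-sparse if $f(H)\ge \ell$ for every subgraph $H$ of $G$ with at least one edge, and $(2,\ell)$-tight if it is $(2,\ell)$-sparse and $f(G)=\ell$. $K_5\setminus e$ is the complete graph on $5$ vertices with one edge removed; $K_4\sqcup K_4$ is the graph formed by two copies of $K_4$ whose intersection is a copy of $K_2$ (one shared edge with its two endpoints). Moves: Henneberg 1 adds a new vertex of degree $2$. Henneberg 2 removes an edge $uv$ and adds a new vertex $x$ with edges $xu,xv,xw$ for some further vertex $w$. Vertex-to-$K_4$ is the inverse of the $K_4$-to-vertex move, which contracts a copy of $K_4$ in $G$ to a single new vertex $v_*$: vertices of the $K_4$ are replaced by $v_*$, edges of the $K_4$ are deleted, and each edge $vw$ with $v\notin K_4$, $w\in K_4$ becomes an edge $vv_*$. Edge-to-$K_3$: given an edge $uv$ where $v$ has neighbours $a_1,\dots,a_n$, delete $v$ and its incident edges, add new vertices $v_1,v_2$ with edges $uv_1,uv_2,v_1v_2$, and join each remaining former neighbour $a_j$ of $v$ to exactly one of $v_1,v_2$ (according to some bipartition,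 one side possibly empty). Edge joining: given $(2,1)$-tight graphs $K$ and $H$ (vertex-disjoint) and vertices $u\in K$, $v\in H$, form $G$ with $V(G)=V(K)\cup V(H)$ and $E(G)=E(K)\cup E(H)\cup\{uv\}$. *)

(* Defs.v *)
From mathcomp Require Import all_boot all_order all_algebra.

Set Implicit Arguments.
Unset Strict Implicit.
Unset Printing Implicit Defensive.

Record sgraph := SGraph {
  vertex :> finType;
  adj : rel vertex;
  adj_sym : symmetric adj;
  adj_irr : irreflexive adj
}.

(* An edge is an unordered pair of vertices, that is, a two-element set. *)
Definition edges (G : sgraph) : {set {set G}} :=
  [set [set p.1; p.2] | p : G * G & adj p.1 p.2].

Definition iso (G H : sgraph) : Prop :=
  exists2 h : G -> H, bijective h & forall x y, adj (h x) (h y) = adj x y.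

(* A subgraph has vertex set A and edge set F, and need not be induced. *)
Definition subgraph (G : sgraph) (A : {set G}) (F : {set {set G}}) : Prop :=
  F \subset edges G /\ cover F \subset A.

Definition freedom (V : finType) (A : {set V}) (F : {set {set V}}) : int :=
  (2 * #|A|%:Z - #|F|%:Z)%R.

Definition sparse (l : nat) (G : sgraph) : Prop :=
  forall (A : {set G}) (F : {set {set G}}),
    subgraph A F -> F != set0 -> (l%:Z <= freedom A F)%R.

Definition tight (l : nat) (G : sgraph) : Prop :=
  sparse l G /\ freedom [set: G] (edges G) = l%:Z%R.

Definition K5e_adj : rel 'I_5 :=
  fun x y => (x != y) && ~~ ((x < 2) && (y < 2)).

Fact K5e_sym : symmetric K5e_adj.
Proof. by move=> x y; rewrite /K5e_adj eq_sym [(x < 2) && _]andbC. Qed.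

Fact K5e_irr : irreflexive K5e_adj.
Proof. by move=> x; rewrite /K5e_adj eqxx. Qed.

Definition K5e : sgraph := SGraph K5e_sym K5e_irr.

(* The two copies of K4 are {0,1,2,3} and {2,3,4,5}. *)
Definition K4K4_adj : rel 'I_6 := fun x y =>
  (x != y) && (((x < 4) && (y < 4)) || ((2 <= x) && (2 <= y))).

Fact K4K4_sym : symmetric K4K4_adj.
Proof.
by move=> x y; rewrite /K4K4_adj eq_sym [(x < 4) && _]andbC
  [(2 <= x) && _]andbC.
Qed.

Fact K4K4_irr : irreflexive K4K4_adj.
Proof. by move=> x; rewrite /K4K4_adj eqxx. Qed.

Definition K4K4 : sgraph := SGraph K4K4_sym K4K4_irr.

(* In the Henneberg moves the new vertex is None. *)
Section Henneberg.
Variable G : sgraph.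

Definition H1_adj (u v : G) : rel (option G) := fun x y =>
  match x, y with
  | Some a, Some b => adj a b
  | Some a, None | None, Some a => a \in [set u; v]
  | None, None => false
  end.

Fact H1_sym u v : symmetric (H1_adj u v).
Proof. by move=> [x|] [y|] //=; rewrite adj_sym. Qed.

Fact H1_irr u v : irreflexive (H1_adj u v).
Proof. by move=> [x|] //=; rewrite adj_irr. Qed.

Definition H1_graph (u v : G) : sgraph := SGraph (H1_sym u v) (H1_irr u v).

Definition H2_adj (u v w : G) : rel (option G) := fun x y =>
  match x, y with
  | Some a, Some b => adj a b && ([set a; b] != [set u; v])
  | Some a, None | None, Some a => a \in [set u; v; w]
  | None, None => false
  end.

Fact H2_sym u v w : symmetric (H2_adj u v w).
Proof. by move=> [x|] [y|] //=; rewrite adj_sym setUC. Qed.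

Fact H2_irr u v w : irreflexive (H2_adj u v w).
Proof. by move=> [x|] //=; rewrite adj_irr. Qed.

Definition H2_graph (u v w : G) : sgraph :=
  SGraph (H2_sym u v w) (H2_irr u v w).

End Henneberg.

Definition henneberg1 (G G' : sgraph) : Prop :=
  exists u v : G, u != v /\ iso (H1_graph u v) G'.

Definition henneberg2 (G G' : sgraph) : Prop :=
  exists u v w : G,
    [/\ adj u v, w != u, w != v & iso (H2_graph u v w) G'].

(* The set K is contracted to the vertex None. *)
Section Contraction.
Variables (G : sgraph) (K : {set G}).

Definition contract_adj : rel (option {x : G | x \notin K}) := fun x y =>
  match x, y with
  | Some a, Some b => adj (val a) (val b)
  | Some a, None | None, Some a => [exists w in K, adj (val a) w]
  | None, None => false
  end.

Fact contract_sym : symmetric contract_adj.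
Proof. by move=> [x|] [y|] //=; rewrite adj_sym. Qed.

Fact contract_irr : irreflexive contract_adj.
Proof. by move=> [x|] //=; rewrite adj_irr. Qed.

Definition contract : sgraph := SGraph contract_sym contract_irr.

End Contraction.

(* The last condition before the isomorphism says that distinct edges stay
   distinct, so that the contracted graph has no parallel edges. *)
Definition K4_to_vertex (G G' : sgraph) : Prop :=
  exists K : {set G},
    [/\ #|K| = 4,
        {in K &, forall x y, x != y -> adj x y},
        forall v, v \notin K ->
          {in K &, forall w w', adj v w -> adj v w' -> w = w'}
      & iso (contract K) G'].

Definition vertex_to_K4 (G G' : sgraph) : Prop := K4_to_vertex G' G.

Section EdgeToK3.
Variables (G : sgraph) (u v : G) (side : G -> bool).

(* The vertices v_1, v_2 are inr true, inr false; a neighbour a of v other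
   than u is joined to inr (side a). *)
Definition K3_adj : rel ({x : G | x != v} + bool)%type := fun x y =>
  match x, y with
  | inl a, inl b => adj (val a) (val b)
  | inl a, inr i | inr i, inl a =>
      (val a == u) || adj (val a) v && (side (val a) == i)
  | inr i, inr j => i != j
  end.

Fact K3_sym : symmetric K3_adj.
Proof. by move=> [x|i] [y|j] //=; rewrite 1?adj_sym 1?eq_sym. Qed.

Fact K3_irr : irreflexive K3_adj.
Proof. by move=> [x|i] /=; rewrite ?adj_irr ?eqxx. Qed.

Definition K3_graph : sgraph := SGraph K3_sym K3_irr.

End EdgeToK3.

Definition edge_to_K3 (G G' : sgraph) : Prop :=
  exists (u v : G) (side : G -> bool),
    adj u v /\ iso (K3_graph u v side) G'.

Section EdgeJoining.
Variables (K H : sgraph) (u : K) (v : H).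

Definition join_adj : rel (K + H)%type := fun x y =>
  match x, y with
  | inl a, inl b => adj a b
  | inr a, inr b => adj a b
  | inl a, inr b | inr b, inl a => (a == u) && (b == v)
  end.

Fact join_sym : symmetric join_adj.
Proof. by move=> [x|x] [y|y] //=; rewrite adj_sym. Qed.

Fact join_irr : irreflexive join_adj.
Proof. by move=> [x|x] /=; rewrite adj_irr. Qed.

Definition join_graph : sgraph := SGraph join_sym join_irr.

End EdgeJoining.

Definition edge_joining (K H G : sgraph) : Prop :=
  [/\ tight 1 K, tight 1 H
    & exists (u : K) (v : H), iso (join_graph u v) G].

(* Edge joining is binary: both of its arguments must have been derived. *)
Inductive derivable : sgraph -> Prop :=
| Derivable_K5e G : iso K5e G -> derivable G
| Derivable_K4K4 G : iso K4K4 G -> derivable G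
| Derivable_henneberg1 G G' : derivable G -> henneberg1 G G' -> derivable G'
| Derivable_henneberg2 G G' : derivable G -> henneberg2 G G' -> derivable G'
| Derivable_vertex_to_K4 G G' :
    derivable G -> vertex_to_K4 G G' -> derivable G'
| Derivable_edge_joining K H G :
    derivable K -> derivable H -> edge_joining K H G -> derivable G
| Derivable_edge_to_K3 G G' : derivable G -> edge_to_K3 G G' -> derivable G'.

(* A spanning subgraph on vertex type V is given by its edge set F. *)
Section Spanning.
Variables (V : finType) (F : {set {set V}}).

Definition edge_rel : rel V := fun x y => [set x; y] \in F.

(* A cycle is identified with its edge set C, so that it does not depend on a
   starting vertex or an orientation. *)
Definition is_cycle (C : {set {set V}}) : Prop :=
  exists p : seq V,
    [/\ (2 < size p), ucycle edge_rel p
      & C = [set [set x; next p x] | x in p]].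

Definition spanning_tree : Prop :=
  [/\ (0 < #|V|),
      forall x y, connect edge_rel x y
    & forall C, ~ is_cycle C].

Definition components_unicyclic : Prop :=
  forall x, exists! C, is_cycle C /\ cover C \subset connect edge_rel x.

End Spanning.

Definition tree_and_unicyclic (G : sgraph) : Prop :=
  exists T P : {set {set G}},
    [/\ T :|: P = edges G, [disjoint T & P],
        spanning_tree T & components_unicyclic P].

(* Main.v *)
Require Import Defs.
From mathcomp Require Import all_boot zify.

(* Write f(X) for the freedom of the subgraph induced by X, and call X tight if
   f(X) = 1; by submodularity, tight sets that meet have tight union and
   intersection.

   (1) -> (2).  A tight graph has a vertex of degree 2 (undo Henneberg 1) or 3.
   A vertex v of degree 3 allows an inverse Henneberg 2 move unless N[v] is a K4,
   and this K4 can be contracted unless an outside vertex x has two neighbours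
   a, b in it.  If x has three, they span K5e.  Otherwise, contracting the edge
   xa of the triangle xab could only fail because of a second common neighbour
   of x and a.  Adding common neighbours repeatedly, the set of vertices stays of
   freedom 2 with no subset of smaller freedom, or becomes tight; a tight set
   would then grow forever, so by finiteness the first common neighbour is
   adjacent to x, a and b, which gives K4K4.  Copies of K5e and K4K4 are
   minimal tight sets, hence disjoint, and as the degrees sum to 4|V| - 2 one of
   them is left by at most one edge: it is the whole graph, or G is an edge
   joining.

   (2) -> (3) -> (1).  The decomposition (3) amounts to an orientation of the
   edges in two classes: the parent arcs of a rooted tree, and one arc out of
   each vertex.  All moves transport such orientations.  In a set X the second
   class has at most |X| arcs, and the first at most |X| - 1, because some vertex
   of X has its parent outside X. *)

Set Implicit Arguments.
Unset Strict Implicit.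
Unset Printing Implicit Defensive.


(** * Counting edges *)

(** The bookkeeping behind (1) -> (2) is that a new vertex adds 2 to the freedom of a set and each
    edge from it into the set takes 1 away. A K4 has freedom 2, so it is not tight but only one edge
    short of it. Attaching a vertex by two edges keeps freedom 2, by three edges makes the set
    tight, and by four is impossible. This leaves so few cases that the common neighbours forced by
    the failure of all edge contractions can be followed one at a time. For the way back, (3) itself
    is a poor invariant: cycles and components are global, and a move may reroute them far from
    where it acts. An orientation stores one value per vertex, so a move changes it only near the
    new vertices. The exception is edge joining, where a tree must first be rerooted. The numbers
    agree: |V| - 1 parent arcs and |V| further arcs make up the 2|V| - 1 edges of a tight graph. *)

Lemma card_setU_disj (T : finType) (A B : {set T}) :
  A :&: B = set0 -> #|A :|: B| = #|A| + #|B|.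
Proof. by rewrite -cardsUI => ->; rewrite cards0 addn0. Qed.

Lemma set_ind (T : finType) (P : {set T} -> Prop) : P set0 ->
  (forall x (A : {set T}), x \notin A -> P A -> P (x |: A)) -> forall A : {set T}, P A.
Proof.
move=> P0 PS A; move cA: #|A| => n; elim: n A cA => [|n IH] A cA.
  by rewrite (cards0_eq cA).
have [E|[x xA]] := set_0Vmem A; first by rewrite E cards0 in cA.
rewrite -(setD1K xA); apply: PS; first by rewrite setD11.
apply: IH.
by move: cA; rewrite (cardsD1 x) xA => -[].
Qed.

Section Counting.
Variable G : sgraph.
Implicit Types (x y : G) (A B C X Y : {set G}).

Definition inner X : {set {set G}} := [set e in edges G | e \subset X].
Definition nbr x : {set G} := [set y | adj x y].

Lemma adj_neq x y : adj x y -> x != y.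
Proof. by apply: contraTneq => ->; rewrite adj_irr. Qed.

Lemma edgesP (e : {set G}) :
  reflect (exists x y, adj x y /\ e = [set x; y]) (e \in edges G).
Proof.
apply: (iffP imsetP) => [[[x y]] /= | [x [y [xy ->]]]].
  by rewrite inE /= => xy ->; exists x, y.
by exists (x, y); rewrite ?inE.
Qed.

Lemma eq_set2P (T : finType) (a b c d : T) :
  [set a; b] = [set c; d] -> (a = c /\ b = d) \/ (a = d /\ b = c).
Proof.
move=> E; have /set2P ha : a \in [set c; d] by rewrite -E set21.
have /set2P hb : b \in [set c; d] by rewrite -E set22.
have /set2P hc : c \in [set a; b] by rewrite E set21.
have /set2P hd : d \in [set a; b] by rewrite E set22.
by case: ha => ?; case: hb => ?; case: hc => ?; case: hd => ?; subst; auto.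
Qed.

Lemma in_edges x y : ([set x; y] \in edges G) = adj x y.
Proof.
apply/edgesP/idP => [[a [b [ab /eq_set2P[[-> ->]|[-> ->]]]]]|xy] //.
  by rewrite adj_sym.
by exists x, y.
Qed.

Lemma innerT : inner setT = edges G.
Proof. by apply/setP=> e; rewrite !inE subsetT andbT. Qed.

Lemma innerS X Y : X \subset Y -> inner X \subset inner Y.
Proof.
move=> XY; apply/subsetP=> e; rewrite !inE => /andP[-> eX].
exact: subset_trans XY.
Qed.

Lemma inner_nonempty X : inner X != set0 -> X != set0.
Proof.
case/set0Pn=> e; rewrite inE => /andP[/edgesP[x [y [_ ->]]] xyX].
by apply/set0Pn; exists x; rewrite (subsetP xyX) ?set21.
Qed.

Lemma inner0 : inner set0 = set0.
Proof. by apply/eqP; apply: contraTT (eqxx (@set0 G)); apply: inner_nonempty. Qed.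

Lemma card_innerU1 x X : x \notin X ->
  #|inner (x |: X)| = #|inner X| + #|nbr x :&: X|.
Proof.
move=> xX.
have inj : {in nbr x :&: X &, injective (fun y => [set x; y])}.
  by move=> y z _ _ /eq_set2P[[]|[<- ->]].
rewrite -(card_in_imset inj) -card_setU_disj; last first.
  apply/setP=> e; rewrite !inE; apply/negbTE/negP=> /andP[/andP[_ eX]] /imsetP[y _ Ee].
  by case/negP: xX; apply: (subsetP eX); rewrite Ee set21.
apply: eq_card => e; rewrite !inE.
apply/andP/orP => [[ee eX]|[/andP[-> eX]|/imsetP[y]]].
- have /edgesP[a [b [ab Ee]]] := ee; subst e.
  move: eX; rewrite subUset !sub1set !inE.
  case: (eqVneq a x) => [Ea|ax]; case: (eqVneq b x) => [Eb|bx] /=; rewrite ?andbT => aX.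
  + by move: (adj_neq ab); rewrite Ea Eb eqxx.
  + by right; apply/imsetP; exists b; rewrite ?inE -?Ea ?ab.
  + by right; apply/imsetP; exists a; rewrite 1?setUC ?inE -?Eb 1?adj_sym ?ab.
  + by left; rewrite ee subUset !sub1set.
- by split=> //; apply: subset_trans eX (subsetUr _ _).
- rewrite !inE => /andP[xy yX] ->; rewrite in_edges xy; split=> //.
  by rewrite subUset !sub1set !inE eqxx yX orbT.
Qed.

Lemma card_innerD1 x X : x \in X ->
  #|inner X| = #|inner (X :\ x)| + #|nbr x :&: X|.
Proof.
move=> xX; rewrite -{1}(setD1K xX) card_innerU1 ?setD11 //; congr (_ + _).
by apply: eq_card => y; rewrite !inE; case: eqP => // ->; rewrite adj_irr.
Qed.

(** Edges inside [A] or inside [B] stay inside the union, and those inside both stay inside the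
    intersection. As cardinality is modular, this is the submodularity of freedom. *)
Lemma inner_supermodular A B :
  #|inner A| + #|inner B| <= #|inner (A :|: B)| + #|inner (A :&: B)|.
Proof.
rewrite -cardsUI leq_add //; apply: subset_leq_card.
  by rewrite subUset !innerS ?subsetUl ?subsetUr.
by apply/subsetP=> e; rewrite !inE subsetI => /andP[/andP[-> ->] /andP[_ ->]].
Qed.

(* The number of edges between [A] and [B] when these are disjoint; an edge
   inside [A :&: B] is counted twice. *)
Definition links A B := \sum_(x in A) #|nbr x :&: B|.

Lemma card_nbrI x B : #|nbr x :&: B| = \sum_(y in B) adj x y.
Proof.
rewrite -sum1_card big_mkcond [RHS]big_mkcond; apply: eq_bigr => y _.
by rewrite !inE; case: (y \in B); case: adj.
Qed.

Lemma links_sym A B : links A B = links B A.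
Proof.
rewrite /links (eq_bigr _ (fun x _ => card_nbrI x B)) exchange_big.
by apply: eq_bigr => y _; rewrite card_nbrI; apply: eq_bigr => x _; rewrite adj_sym.
Qed.

Lemma linksU A B C : [disjoint B & C] -> links A (B :|: C) = links A B + links A C.
Proof.
move=> BC; rewrite -big_split; apply: eq_bigr => x _ /=.
rewrite setIUr card_setU_disj //.
apply/eqP; rewrite -subset0 -(disjoint_setI0 BC).
by apply/subsetP=> y; rewrite !inE; case/andP=> /andP[_ ->] /andP[_ ->].
Qed.

Lemma links1 x B : links [set x] B = #|nbr x :&: B|.
Proof. by rewrite /links big_set1. Qed.

Lemma card_innerU A B : [disjoint A & B] ->
  #|inner (A :|: B)| = #|inner A| + #|inner B| + links A B.
Proof.
elim/set_ind: A => [|x A xA IH].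
  by rewrite set0U /links big_set0 addn0 inner0 cards0.
rewrite disjoints_subset subUset sub1set -disjoints_subset inE => /andP[xB AB].
rewrite -setUA !card_innerU1 ?inE ?negb_or ?xA ?IH // /links big_setU1 //= -!links1 linksU //.
by lia.
Qed.

Lemma double_inner X : 2 * #|inner X| = links X X.
Proof.
elim/set_ind: X => [|x X xX IH].
  by rewrite /links big_set0 inner0 cards0.
have d1 : [disjoint [set x] & X] by rewrite disjoints1.
rewrite card_innerU1 // mulnDr IH linksU // ![links (x |: X) _]links_sym !linksU //.
rewrite [links X [set x]]links_sym !links1.
suff -> : #|nbr x :&: [set x]| = 0 by lia.
by apply: eq_card0 => y; rewrite !inE; case: eqP => [->|]; rewrite ?adj_irr ?andbF.
Qed.

Lemma sum_degree : \sum_(x : G) #|nbr x| = 2 * #|edges G|.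
Proof.
rewrite -innerT double_inner /links; apply: eq_big => [x|x _]; rewrite ?inE //.
by rewrite setIT.
Qed.

(** A form without integers or arbitrary edge sets: the induced subgraph has the least freedom on
    its vertex set, and an edgeless nonempty set satisfies the bound anyway. *)
Lemma tightP : tight 1 G <->
  (forall X, X != set0 -> #|inner X| < 2 * #|X|) /\ #|edges G|.+1 = 2 * #|G|.
Proof.
rewrite /tight /sparse /freedom cardsT; split=> [[sp tot]|[sp tot]]; split.
- move=> X X0; have [->|I0] := eqVneq (inner X) set0.
    by rewrite cards0 muln_gt0 card_gt0.
  have sg : subgraph X (inner X).
    split; first by apply/subsetP=> e; rewrite inE => /andP[].
    by apply/bigcupsP=> e; rewrite inE => /andP[].
  by have := sp _ _ sg I0; lia.
- by lia.
- move=> A F [FE FA] F0.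
  have FI : F \subset inner A.
    apply/subsetP=> e eF; rewrite inE (subsetP FE) //=.
    by apply: subset_trans FA; apply: bigcup_sup.
  have /sp : A != set0.
    apply: inner_nonempty; apply: contraNneq F0 => E.
    by move: FI; rewrite E subset0.
  by have := subset_leq_card FI; lia.
- by lia.
Qed.

End Counting.

(** The conditions on [h] are local to [X] because the maps out of contracted and merged graphs
    preserve adjacency only away from the new vertex. *)
Lemma card_inner_imset (G H : sgraph) (h : G -> H) (X : {set G}) :
  {in X &, injective h} -> {in X &, forall x y, adj (h x) (h y) = adj x y} ->
  #|inner (h @: X)| = #|inner X|.
Proof.
elim/set_ind: X => [|x X xX IH] inj hom.
  by rewrite imset0 !inner0 !cards0.
have XX : {subset X <= x |: X} by move=> y yX; rewrite inE yX orbT.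
have xx : x \in x |: X by rewrite setU11.
rewrite imsetU1 card_innerU1; last first.
  apply: contra xX => /imsetP[y yX /inj]; rewrite xx XX // => E.
  by rewrite E.
rewrite card_innerU1 // IH; first last.
- by move=> a b aX bX; apply: hom; apply: XX.
- by move=> a b aX bX; apply: inj; apply: XX.
congr (_ + _); rewrite -[in RHS](@card_in_imset _ _ h); last first.
  by move=> a b; rewrite !inE => /andP[_ aX] /andP[_ bX]; apply: inj; apply: XX.
apply: eq_card => y; apply/setIP/imsetP => [[]|[z]].
  rewrite inE => a /imsetP[z zX E]; exists z => //.
  by rewrite !inE zX andbT -(hom _ _ xx (XX _ zX)) -E.
rewrite !inE => /andP[a zX ->]; rewrite (hom _ _ xx (XX _ zX)); split=> //.
exact: imset_f.
Qed.


(** * Tight sets and triangles *)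

Section Bounds.
Variable G : sgraph.
Implicit Types (x y : G) (X Y : {set G}).

Lemma double_inner_le X : 2 * #|inner X| <= #|X| * #|X|.-1.
Proof.
rewrite double_inner -sum_nat_const; apply: leq_sum => x xX.
apply: leq_trans (subset_leq_card _) (_ : #|X :\ x| <= _).
  by apply/subsetP=> y; rewrite !inE => /andP[/adj_neq]; rewrite eq_sym => -> ->.
by rewrite (cardsD1 x X) xX.
Qed.

Lemma double_inner_clique X : {in X &, forall x y, x != y -> adj x y} ->
  2 * #|inner X| = #|X| * #|X|.-1.
Proof.
move=> cl; rewrite double_inner -sum_nat_const; apply: eq_bigr => x xX.
rewrite [in RHS](cardsD1 x X) xX /=.
apply: eq_card => y; rewrite !inE [y == x]eq_sym.
by apply/andP/andP => [[/adj_neq]|[xy yX]] //; rewrite cl.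
Qed.

Lemma nbr_setIU1 x X : nbr x :&: (x |: X) = nbr x :&: X.
Proof.
rewrite setIUr [X in X :|: _](_ : _ = set0) ?set0U //.
by apply/setP=> y; rewrite !inE; case: eqP => [->|]; rewrite ?adj_irr ?andbF.
Qed.

(* The sets spanning a subgraph of freedom 1. *)
Definition tset X := (#|inner X|).+1 == 2 * #|X|.

Lemma tset_nonempty X : tset X -> X != set0.
Proof. by apply: contraTneq => ->; rewrite /tset cards0. Qed.

(** For 1 <= n <= 4 even the complete graph has n(n-1)/2 < 2n - 1 edges. *)
Lemma tset_ge5 X : tset X -> 4 < #|X|.
Proof. by move/eqP=> t; have := double_inner_le X; nia. Qed.

End Bounds.

Section Core.
Variable G : sgraph.
Implicit Types (x y p q r w : G) (R S X Y Z : {set G}).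
Hypothesis sparseG : forall X, X != set0 -> #|inner X| < 2 * #|X|.

(** Three edges from [w] into [R] would leave freedom 1 + 2 - 3 = 0. *)
Lemma card_nbr_tset R w : tset R -> w \notin R -> #|nbr w :&: R| <= 2.
Proof.
move=> /eqP tR wR; have := card_innerU1 wR.
have /sparseG : w |: R != set0 by apply/set0Pn; exists w; rewrite setU11.
by rewrite cardsU1 wR; lia.
Qed.

Lemma tset_setI X Y : tset X -> tset Y -> X :&: Y != set0 -> tset (X :&: Y).
Proof.
move=> /eqP tX /eqP tY XY; have [/set0Pn[z /setIP[zX _]]] := (XY).
have /sparseG : X :|: Y != set0 by apply/set0Pn; exists z; rewrite inE zX.
have := sparseG XY; have := inner_supermodular X Y; have := cardsUI X Y.
by rewrite /tset; lia.
Qed.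

(* No edge of a triangle can be contracted by an inverse edge-to-K3 move: the
   result would have a parallel edge, or a subgraph of freedom 0 obtained from
   a tight set that avoids the third vertex. *)
Hypothesis noK3 : forall x p q, adj x p -> adj x q -> adj p q ->
  (exists w, [/\ w != q, adj w x & adj w p]) \/
  (exists Y, [/\ tset Y, x \in Y, p \in Y & q \notin Y]).

(* Otherwise the third vertices given by [noK3] could be added to [R] forever. *)
Lemma tset_no_outer_triangle R y p q : tset R -> y \notin R -> p \in R -> q \in R ->
  adj p q -> adj y p -> adj y q -> False.
Proof.
have [n] := ubnP #|~: R|; elim: n R y p q => // n IH R y p q nR tR yR pR qR pq yp yq.
have E : nbr y :&: R = [set p; q].
  apply/eqP; rewrite eq_sym eqEcard cards2 (adj_neq pq) card_nbr_tset // andbT.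
  by rewrite subUset !sub1set !inE yp yq pR.
have cR' : #|y |: R| = #|R|.+1 by rewrite cardsU1 yR.
have eR' : #|inner (y |: R)| = #|inner R| + 2.
  by rewrite card_innerU1 // E cards2 (adj_neq pq).
have tR' : tset (y |: R) by move: tR; rewrite /tset; lia.
have [[w [wq wy wp]]|[Y [tY yY pY qY]]] := noK3 yp yq pq.
- have wR : w \notin R.
    apply/negP=> wR; have : w \in nbr y :&: R by rewrite !inE adj_sym wy.
    by rewrite E !inE (negbTE wq) orbF => /eqP w_p; rewrite w_p adj_irr in wp.
  apply: (IH (y |: R) w y p) => //; rewrite ?setU11 ?inE ?pR ?orbT //.
    by have := cardsC R; have := cardsC (y |: R); move: nR cR'; clear; lia.
  by rewrite (negbTE wR) orbF; apply: adj_neq.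
(* Here submodularity fails: [y] has at most the neighbour [p] in [Y :&: R], so [Y :&: (y |: R)] has
   freedom at least 1 + 2 - 1 = 2, and the union of [Y] and [y |: R] would have freedom at most
   0. *)
- have yYR : y \notin Y :&: R by rewrite inE (negbTE yR) andbF.
  have EI : Y :&: (y |: R) = y |: (Y :&: R).
    by rewrite setIUr; congr (_ :|: _); apply/setIidPr; rewrite sub1set.
  have le1 : #|nbr y :&: (Y :&: R)| <= 1.
    rewrite -(cards1 p); apply: subset_leq_card; apply/subsetP=> z /setIP[yz /setIP[zY zR]].
    have : z \in nbr y :&: R by rewrite inE yz.
    by rewrite E !inE => /orP[//|/eqP zq]; rewrite -zq zY in qY.
  have /sparseG : Y :&: R != set0 by apply/set0Pn; exists p; rewrite inE pY.
  have /sparseG : Y :|: (y |: R) != set0 by apply/set0Pn; exists y; rewrite inE yY.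
  have := inner_supermodular Y (y |: R); have := cardsUI Y (y |: R).
  rewrite EI (card_innerU1 yYR) cardsU1 yYR.
  by move: tY tR tR' le1; rewrite /tset; clear; lia.
Qed.

(* [S] spans a subgraph of freedom 2, and no smaller freedom occurs inside it. *)
Definition slack2 S :=
  #|inner S|.+2 = 2 * #|S| /\
  forall Z, Z \subset S -> Z != set0 -> #|inner Z|.+2 <= 2 * #|Z|.

(** A subset containing [w] sees at most two of its edges, so [w] never lowers the freedom. *)
Lemma slack2U1 S w : slack2 S -> w \notin S -> #|nbr w :&: S| = 2 -> slack2 (w |: S).
Proof.
move=> [eS sS] wS nw; split; first by rewrite card_innerU1 // cardsU1 wS; lia.
move=> Z ZS Z0; have [wZ|wZ] := boolP (w \in Z); last first.
  apply: sS => //; apply/subsetP=> z zZ; move: (subsetP ZS _ zZ).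
  by rewrite !inE; case: eqP => // zw; rewrite -zw zZ in wZ.
have ZwS : Z :\ w \subset S by rewrite subDset.
rewrite (card_innerD1 wZ) (cardsD1 w Z) wZ.
have : #|nbr w :&: Z| <= #|nbr w :&: S|.
  apply: subset_leq_card; apply/subsetP=> z /setIP[wz zZ]; rewrite inE wz /=.
  move: (subsetP ZS _ zZ); rewrite !inE; case: eqP => // zw.
  by move: wz; rewrite zw inE adj_irr.
(* The bound for subsets of [S] does not apply to the empty set; there [Z] is the single vertex [w],
   of freedom 2. *)
have [Z1|Z1] := eqVneq (Z :\ w) set0; last by have := sS _ ZwS Z1; lia.
rewrite Z1 inner0 !cards0 => _; rewrite [nbr w :&: Z](_ : _ = set0) ?cards0 //.
apply/setP=> z; rewrite !inE; apply/negbTE/negP=> /andP[wz zZ].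
have : z \in Z :\ w by rewrite !inE zZ eq_sym (adj_neq wz).
by rewrite Z1 inE.
Qed.

(* A tight set containing [x] and [p] but not [q] would meet [S] in a set of
   freedom at least 3, hence cannot exist. *)
Lemma slack2_outer_triangle S x p q : slack2 S -> x \in S -> nbr x :&: S = [set p; q] ->
  adj p q -> exists w, [/\ w \notin S, adj w x & adj w p].
Proof.
move=> [eS sS] xS E pq.
have /setIP[] : p \in nbr x :&: S by rewrite E set21.
have /setIP[] : q \in nbr x :&: S by rewrite E set22.
rewrite !inE => xq qS xp pS.
have [[w [wq wx wp]]|[Y [tY xY pY qY]]] := noK3 xp xq pq.
  exists w; split=> //; apply/negP=> wS.
  have : w \in nbr x :&: S by rewrite !inE adj_sym wx.
  by rewrite E !inE (negbTE wq) orbF => /eqP w_p; rewrite w_p adj_irr in wp.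
exfalso; have xZ : x \in Y :&: S by rewrite inE xY.
(* As [q] is outside [Y], only [p] can be a neighbour of [x] here. Without [x] the intersection has
   freedom at least 2, and [x] adds at least 2 - 1. *)
have le1 : #|nbr x :&: (Y :&: S)| <= 1.
  rewrite -(cards1 p); apply: subset_leq_card; apply/subsetP=> z /setIP[xz /setIP[zY zS]].
  have : z \in nbr x :&: S by rewrite inE xz.
  by rewrite E !inE => /orP[//|/eqP zq]; rewrite -zq zY in qY.
have sub : (Y :&: S) :\ x \subset S by apply: subset_trans (subD1set _ _) (subsetIr _ _).
have := sS _ sub; have -> : (Y :&: S) :\ x != set0.
  by apply/set0Pn; exists p; rewrite !inE pY pS eq_sym (adj_neq xp).
move=> /(_ isT).
have /sparseG : Y :|: S != set0 by apply/set0Pn; exists p; rewrite inE pY.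
have := inner_supermodular Y S; have := cardsUI Y S.
rewrite (card_innerD1 xZ) (cardsD1 x (Y :&: S)) xZ.
by move: tY eS le1; rewrite /tset; clear; lia.
Qed.

Lemma tset_slack2U1 S w : slack2 S -> w \notin S -> #|nbr w :&: S| = 3 -> tset (w |: S).
Proof. by move=> [eS _] wS nw; rewrite /tset card_innerU1 // cardsU1 wS; lia. Qed.

Lemma card_nbr_slack2 S w : slack2 S -> w \notin S -> #|nbr w :&: S| <= 3.
Proof.
move=> [eS _] wS; have := card_innerU1 wS.
have /sparseG : w |: S != set0 by apply/set0Pn; exists w; rewrite setU11.
by rewrite cardsU1 wS; lia.
Qed.

Lemma set3_swap x p q S : nbr x :&: S = [set p; q] -> nbr x :&: S = [set q; p].
Proof. by rewrite [in RHS]setUC. Qed.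

(* The common neighbour [w] of [x] and [p] either has only these two
   neighbours in [S], and [S] can be replaced by [w |: S], or makes [w |: S]
   tight and by [tset_no_outer_triangle] has too many neighbours in [S]. *)
Lemma slack2_no_pending S x p q y r z :
  slack2 S -> x \in S -> nbr x :&: S = [set p; q] -> adj p q ->
  y \in S -> r \in S -> adj y r -> ~~ ([set y; r] \subset [set x; p; q]) ->
  z \notin S -> adj z y -> adj z r -> False.
Proof.
have [n] := ubnP #|~: S|; elim: n S x p q y r z => // n IH S x p q y r z nS.
move=> sS xS E pq yS rS yr yrN zS zy zr.
have /setIP[] : p \in nbr x :&: S by rewrite E set21.
have /setIP[] : q \in nbr x :&: S by rewrite E set22.
rewrite !inE => xq qS xp pS.
have [w [wS wx wp]] := slack2_outer_triangle sS xS E pq.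
have qp : adj q p by rewrite adj_sym.
have [w' [w'S w'x w'q]] := slack2_outer_triangle sS xS (set3_swap E) qp.
have sub2 : [set x; p] \subset nbr w :&: S.
  by rewrite subUset !sub1set !inE wx wp xS.
have c2 : #|[set x; p]| = 2 by rewrite cards2 (adj_neq xp).
have [nw|nw] := eqVneq #|nbr w :&: S| 2; last first.
  have nw3 : #|nbr w :&: S| = 3.
    have := card_nbr_slack2 sS wS; have := subset_leq_card sub2.
    by rewrite c2; move: nw; clear; lia.
  have tR := tset_slack2U1 sS wS nw3.
  have RS u : u \in S -> u \in w |: S by move=> uS; rewrite inE uS orbT.
  (* Since [w |: S] is tight, no other vertex completes a triangle over an edge of [S]. Thus [w']
     and [z] are both [w], which is then adjacent to [x], [p], [q], [y] and [r], too many for three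
     neighbours. *)
  have outer u a b : u \notin S -> a \in S -> b \in S -> adj a b -> adj u a -> adj u b -> u = w.
    move=> uS aS bS ab ua ub; case: (eqVneq u w) => // uw; exfalso.
    by apply: (@tset_no_outer_triangle (w |: S) u a b); rewrite ?inE ?aS ?bS ?orbT ?negb_or ?uw.
  have wq : adj w q by rewrite -(outer w' x q).
  have [wy wr] : adj w y /\ adj w r by rewrite -(outer z y r).
  have sub3 : [set x; p; q] \subset nbr w :&: S.
    by rewrite !subUset !sub1set !inE wx wp wq xS pS.
  have E3 : [set x; p; q] = nbr w :&: S.
    apply/eqP; rewrite eqEcard sub3 nw3 [_ :|: [set q]]setUC cardsU1 c2 !inE.
    by rewrite ![q == _]eq_sym negb_or (adj_neq xq) (adj_neq pq).
  by case/negP: yrN; rewrite E3 subUset !sub1set !inE wy wr yS.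
have Ew : nbr w :&: S = [set x; p].
  by apply/eqP; rewrite eq_sym eqEcard sub2 c2 nw.
have wq : ~~ adj w q.
  apply/negP=> wq; have : q \in nbr w :&: S by rewrite !inE wq.
  by rewrite Ew !inE ![q == _]eq_sym (negbTE (adj_neq xq)) (negbTE (adj_neq pq)).
(* The new triangle is [w x p], and [w'] over the edge [x q] is left pending. *)
apply: (IH (w |: S) w x p x q w') => //.
- by have := cardsC S; have := cardsC (w |: S); rewrite cardsU1 wS; move: nS; clear; lia.
- exact: slack2U1.
- exact: setU11.
- by rewrite nbr_setIU1.
- by rewrite inE xS orbT.
- by rewrite inE qS orbT.
- apply/negP=> /subsetP/(_ q); rewrite !inE eqxx orbT => /(_ isT).
  rewrite ![q == _]eq_sym (negbTE (adj_neq xq)) (negbTE (adj_neq pq)) !orbF => /eqP wE.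
  by rewrite wE qS in wS.
- rewrite !inE negb_or w'S andbT; apply: contraNneq wq => <-.
  by [].
Qed.

(** The edges [x p] and [x q] each have a common neighbour outside [S]. If these are not one vertex,
    then after adding the first the second is either a pending triangle over a slack set or an outer
    triangle over a tight one, and both are excluded. *)
Lemma slack2_apex S x p q : slack2 S -> x \in S -> nbr x :&: S = [set p; q] -> adj p q ->
  exists w, [/\ w \notin S, adj w x, adj w p & adj w q].
Proof.
move=> sS xS E pq.
have /setIP[] : p \in nbr x :&: S by rewrite E set21.
have /setIP[] : q \in nbr x :&: S by rewrite E set22.
rewrite !inE => xq qS xp pS.
have [w [wS wx wp]] := slack2_outer_triangle sS xS E pq.
have qp : adj q p by rewrite adj_sym.
have [w' [w'S w'x w'q]] := slack2_outer_triangle sS xS (set3_swap E) qp.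
have [wq|wq] := boolP (adj w q); first by exists w.
have w'w : w' != w by apply: contraNneq wq => <-.
exfalso.
have sub2 : [set x; p] \subset nbr w :&: S.
  by rewrite subUset !sub1set !inE wx wp xS.
have c2 : #|[set x; p]| = 2 by rewrite cards2 (adj_neq xp).
have [nw|nw] := eqVneq #|nbr w :&: S| 2.
  have Ew : nbr w :&: S = [set x; p].
    by apply/eqP; rewrite eq_sym eqEcard sub2 c2 nw.
  apply: (@slack2_no_pending (w |: S) w x p x q w') => //.
  - exact: slack2U1.
  - exact: setU11.
  - by rewrite nbr_setIU1.
  - by rewrite inE xS orbT.
  - by rewrite inE qS orbT.
  - apply/negP=> /subsetP/(_ q); rewrite !inE eqxx orbT => /(_ isT).
    rewrite ![q == _]eq_sym (negbTE (adj_neq xq)) (negbTE (adj_neq pq)) !orbF => /eqP wE.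
    by rewrite wE qS in wS.
  - by rewrite !inE negb_or w'S andbT.
have nw3 : #|nbr w :&: S| = 3.
  have := card_nbr_slack2 sS wS; have := subset_leq_card sub2.
  by rewrite c2; move: nw; clear; lia.
have tR := tset_slack2U1 sS wS nw3.
have RS u : u \in S -> u \in w |: S by move=> uS; rewrite inE uS orbT.
by apply: (@tset_no_outer_triangle (w |: S) w' x q); rewrite ?inE ?xS ?qS ?orbT ?negb_or ?w'w.
Qed.

End Core.


(** * Copies of the two base graphs *)

Definition copy (B G : sgraph) (R : {set G}) := exists h : B -> G,
  [/\ injective h, forall x y, adj (h x) (h y) = adj x y & R = h @: setT].

Definition base_copy (G : sgraph) (R : {set G}) := copy K5e R \/ copy K4K4 R.

(** For a concrete graph on an ordinal the right-hand side evaluates by computation. *)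
Lemma card_edges_pairs (G : sgraph) : 2 * #|edges G| = \sum_(x : G) \sum_(y : G) adj x y.
Proof.
rewrite -sum_degree; apply: eq_bigr => x _.
by rewrite -[nbr x]setIT card_nbrI; apply: eq_bigl => y; rewrite inE.
Qed.

Lemma card_edges_K5e : #|edges K5e| = 9.
Proof.
suff : 2 * #|edges K5e| = 18 by lia.
by rewrite card_edges_pairs /= !big_ord_recl !big_ord0.
Qed.

Lemma card_edges_K4K4 : #|edges K4K4| = 11.
Proof.
suff : 2 * #|edges K4K4| = 22 by lia.
by rewrite card_edges_pairs /= !big_ord_recl !big_ord0.
Qed.

Lemma K4K4_degree (x : K4K4) : 2 < #|nbr x|.
Proof.
rewrite -[nbr x]setIT card_nbrI (eq_bigl predT); last by move=> y; rewrite inE.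
rewrite /= !big_ord_recl !big_ord0.
by case: x => [[|[|[|[|[|[|//]]]]]] ?].
Qed.

Lemma card_copy (B G : sgraph) (R : {set G}) : copy B R ->
  #|R| = #|B| /\ #|inner R| = #|edges B|.
Proof.
case=> h [inj hom ->]; split; first by rewrite card_imset // cardsT.
by rewrite card_inner_imset ?innerT // => x y _ _ //; apply: inj.
Qed.

Lemma copy_degree (B G : sgraph) (R : {set G}) d : copy B R -> (forall x : B, d <= #|nbr x|) ->
  forall x, x \in R -> d <= #|nbr x :&: R|.
Proof.
case=> h [inj hom ->] dB x /imsetP[y _ ->]; apply: leq_trans (dB y) _.
rewrite -(card_imset _ inj); apply: subset_leq_card; apply/subsetP=> z /imsetP[u].
by rewrite !inE => yu ->; rewrite hom yu imset_f.
Qed.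

Lemma base_copy_tset (G : sgraph) (R : {set G}) : base_copy R -> tset R.
Proof.
by rewrite /tset; case=> /card_copy[-> ->];
  rewrite ?card_edges_K5e ?card_edges_K4K4 card_ord.
Qed.

(* A tight set has at least 5 vertices, and deleting a vertex of degree 3 from
   [K4K4] does not leave a tight set. *)
Lemma base_copy_minimal (G : sgraph) (R Z : {set G}) :
  base_copy R -> tset Z -> Z \subset R -> Z = R.
Proof.
move=> bR tZ ZR; have Z5 := tset_ge5 tZ; apply/eqP; rewrite eqEcard ZR /=.
case: bR => cR; have [cR1 cR2] := card_copy cR; rewrite cR1 card_ord //.
rewrite card_ord in cR1; rewrite card_edges_K4K4 in cR2.
rewrite ltnNge; apply/negP=> Z5'.
have /eqP/cards1P[z Ez] : #|R :\: Z| = 1 by have := cardsID Z R; rewrite (setIidPr ZR); lia.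
have /setDP[zR _] : z \in R :\: Z by rewrite Ez set11.
have EZ : Z = R :\ z.
  by rewrite -Ez setDDr setDv set0U; apply/esym/setIidPr.
have := copy_degree cR K4K4_degree zR; have := card_innerD1 zR.
by move: tZ; rewrite /tset -EZ; lia.
Qed.

Section Finding.
Variable G : sgraph.
Implicit Types (x y p q r w : G) (R S X Y Z : {set G}).
Hypothesis sparseG : forall X, X != set0 -> #|inner X| < 2 * #|X|.

Lemma copyI (n : nat) (B : rel 'I_n) (sB : symmetric B) (iB : irreflexive B)
    (s : seq G) (x0 : G) : size s = n -> uniq s ->
  (forall i j : 'I_n, i < j -> adj (nth x0 s i) (nth x0 s j) = B i j) ->
  copy (SGraph sB iB) [set x in s].
Proof.
move=> sz us hom; exists (fun i => nth x0 s (nat_of_ord i)); split.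
- by move=> i j /eqP; rewrite nth_uniq ?sz // => /eqP/val_inj.
- move=> i j /=; have [ij|ji|/val_inj->] := ltngtP i j; first exact: hom.
  + by rewrite adj_sym sB hom.
  + by rewrite iB adj_irr.
- apply/setP=> x; rewrite inE; apply/idP/imsetP => [xs|[i _ ->]].
    have ix : index x s < n by rewrite -sz index_mem.
    by exists (Ordinal ix); rewrite ?inE //= nth_index.
  by rewrite mem_nth ?sz.
Qed.

Hypothesis noK3 : forall x p q, adj x p -> adj x q -> adj p q ->
  (exists w, [/\ w != q, adj w x & adj w p]) \/
  (exists Y, [/\ tset Y, x \in Y, p \in Y & q \notin Y]).

(** Cliques on 1, 2, 3, 4 vertices have freedom 2, 3, 3, 2. *)
Lemma clique4_slack2 (K : {set G}) : #|K| = 4 -> {in K &, forall x y, x != y -> adj x y} ->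
  slack2 K.
Proof.
move=> K4 cl; split; first by have := double_inner_clique cl; rewrite K4; lia.
move=> Z /subset_leq_card ZK; rewrite -card_gt0 => Z0; have := double_inner_le Z.
by rewrite K4 in ZK; case: #|Z| Z0 ZK => [|[|[|[|[|]]]]] //; lia.
Qed.

Lemma base_copy_at v a b c x :
  nbr v = [set a; b; c] -> adj a b -> adj a c -> adj b c ->
  x != v -> x \notin nbr v -> adj x a -> adj x b ->
  exists2 R, base_copy R & v \in R.
Proof.
move=> Ev ab ac bc xv xNv xa xb.
have vE y : adj v y = (y == a) || (y == b) || (y == c).
  by have /setP/(_ y) := Ev; rewrite !inE.
have va : adj v a by rewrite vE eqxx.
have vb : adj v b by rewrite vE eqxx orbT.
have vc : adj v c by rewrite vE eqxx orbT.
have vx : adj v x = false by apply/negbTE; rewrite inE in xNv.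
(* If [x] sees all of [a], [b], [c], the only missing edge is [v x]; these two come first in the
   list because 0 and 1 are the nonadjacent vertices of [K5e]. *)
have [xc|xc] := boolP (adj x c).
  have us : uniq [:: v; x; a; b; c].
    rewrite /= !inE !negb_or !(adj_neq va, adj_neq vb, adj_neq vc, adj_neq xa, adj_neq xb).
    by rewrite (adj_neq xc) (adj_neq ab) (adj_neq ac) (adj_neq bc) eq_sym xv.
  exists [set y in [:: v; x; a; b; c]]; last by rewrite inE mem_head.
  left; apply: (@copyI _ _ _ _ _ v) => // -[i Hi] [j Hj] /=.
  move: i j Hi Hj => [|[|[|[|[|//]]]]] [|[|[|[|[|//]]]]] //= _ _ _;
  by rewrite ?(va, vb, vc, vx, xa, xb, xc, ab, ac, bc).
set K := [set v; c; a; b].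
have usK : uniq [:: v; c; a; b].
  rewrite /= !inE !negb_or !(adj_neq va, adj_neq vb, adj_neq vc).
  by rewrite ![c == _]eq_sym (adj_neq ab) (adj_neq ac) (adj_neq bc).
have EK : K = [set y in [:: v; c; a; b]] by apply/setP=> y; rewrite !inE !orbA.
have cK : #|K| = 4 by rewrite EK cardsE (card_uniqP usK).
have clK : {in K &, forall y z, y != z -> adj y z}.
  have adjs := (va, vb, vc, ab, ac, bc).
  have sdja : (adj a v = true) * (adj b v = true) * (adj c v = true) *
    (adj b a = true) * (adj c a = true) * (adj c b = true).
    by rewrite ![adj _ v]adj_sym [adj b a]adj_sym ![adj c _]adj_sym va vb vc ab ac bc.
  move=> y z; rewrite !inE -!orbA.
  by do 2!(case/or4P=> /eqP->); rewrite ?eqxx ?adjs ?sdja.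
have slK := clique4_slack2 cK clK.
have xK : x \notin K.
  rewrite !inE (negbTE xv) (negbTE (adj_neq xa)) (negbTE (adj_neq xb)) !orbF.
  by apply: contraNneq xNv => ->; rewrite inE.
have ExK : nbr x :&: K = [set a; b].
  apply/setP=> y; rewrite !inE; apply/andP/orP => [[xy]|].
    rewrite -!orbA; case/or4P=> /eqP Ey; subst y; rewrite ?eqxx; auto.
      by rewrite adj_sym vx in xy.
    by rewrite xy in xc.
  by case=> /eqP->; rewrite ?xa ?xb ?eqxx ?orbT.
have sl1 : slack2 (x |: K) by apply: slack2U1 => //; rewrite ExK cards2 (adj_neq ab).
have E1 : nbr x :&: (x |: K) = [set a; b].
  by rewrite nbr_setIU1.
(* The apex [w] over the triangle [x a b] completes the second K4, on [a], [b], [x] and [w]. *)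
have [w [wS wx wa wb]] := slack2_apex sparseG noK3 sl1 (setU11 _ _) E1 ab.
have sub3 : [set x; a; b] \subset nbr w :&: (x |: K).
  by rewrite !subUset !sub1set !inE wx wa wb !eqxx !orbT.
have c3 : #|[set x; a; b]| = 3.
  by rewrite -setUA cardsU1 cards2 (adj_neq ab) !inE negb_or (adj_neq xa) (adj_neq xb).
have Ew : nbr w :&: (x |: K) = [set x; a; b].
  by apply/eqP; rewrite eq_sym eqEcard sub3 c3 card_nbr_slack2.
have wc : adj w c = false.
  apply/negP=> wc; have : c \in nbr w :&: (x |: K) by rewrite !inE wc eqxx !orbT.
  rewrite Ew !inE ![c == _]eq_sym (negbTE (adj_neq ac)) (negbTE (adj_neq bc)) !orbF.
  by move/eqP=> E; move: xNv; rewrite inE E vc.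
have wv : adj w v = false.
  rewrite adj_sym vE (negbTE (adj_neq wa)) (negbTE (adj_neq wb)) /=.
  by apply/eqP=> E; move: wS; rewrite E !inE eqxx !orbT.
(* In this order the shared edge [a b] gets the indices 2 and 3, as in [K4K4]. *)
have us : uniq [:: v; c; a; b; x; w].
  move: usK xK wS; rewrite /K /= !inE !negb_or -!andbA => /and5P[-> -> -> -> /and3P[-> -> _]].
  rewrite ![x == _]eq_sym ![w == _]eq_sym.
  by case/and4P=> -> -> -> -> /and5P[-> -> -> -> ->].
exists [set y in [:: v; c; a; b; x; w]]; last by rewrite inE mem_head.
have cx : adj c x = false by rewrite adj_sym (negbTE xc).
right; apply: (@copyI _ _ _ _ _ v) => // -[i Hi] [j Hj] /=.
move: i j Hi Hj => [|[|[|[|[|[|//]]]]]] [|[|[|[|[|[|//]]]]]] //= ? ? _;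
by rewrite ?(va, vb, vc, vx, cx, ab) // adj_sym ?(xa, xb, ac, bc, wx, wa, wb, wc, wv).
Qed.

End Finding.


Lemma tight_edges (G : sgraph) : tight 1 G -> #|edges G|.+1 = 2 * #|G|.
Proof. by case/tightP. Qed.

Lemma tight_sparse (G : sgraph) : tight 1 G ->
  forall X : {set G}, X != set0 -> #|inner X| < 2 * #|X|.
Proof. by case/tightP. Qed.

Lemma tset_setU (G : sgraph) (X Y : {set G}) : tight 1 G ->
  tset X -> tset Y -> X :&: Y != set0 -> tset (X :|: Y).
Proof.
move=> /tight_sparse sp /eqP tX /eqP tY XY; have [/set0Pn[z /setIP[zX _]]] := (XY).
have /sp : X :|: Y != set0 by apply/set0Pn; exists z; rewrite inE zX.
have := sp _ XY; have := inner_supermodular X Y; have := cardsUI X Y.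
by move: tX tY; rewrite /tset; clear; lia.
Qed.

(* Discharging: the degrees sum to [4 * #|G| - 2], whereas a base copy left by at
   least two edges, and each vertex outside the copies, has average degree at
   least 4. *)
Lemma few_links (G : sgraph) : tight 1 G -> (forall v : G, 2 < #|nbr v|) ->
  (forall v : G, #|nbr v| = 3 -> exists2 R, base_copy R & v \in R) ->
  exists2 R : {set G}, base_copy R & links R (~: R) <= 1.
Proof.
move=> tG deg3 H.
have [f fP] : exists f : G -> {set G}, forall v, #|nbr v| = 3 -> base_copy (f v) /\ v \in f v.
  apply: (@fin_all_exists G (fun _ => {set G})
    (fun v R => #|nbr v| = 3 -> base_copy R /\ v \in R)) => v.
  have [/H[R bR vR]|v3] := eqVneq #|nbr v| 3; first by exists R.
  by exists set0 => E; rewrite E in v3.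
have [/forall_inP big|] :=
  boolP [forall v in [set v | #|nbr v| == 3], 1 < links (f v) (~: f v)]; last first.
  case/forall_inPn=> v; rewrite inE => /eqP/fP[bR _]; rewrite -leqNgt.
  by exists (f v).
exfalso; pose P := f @: [set v | #|nbr v| == 3].
have PP R : R \in P -> base_copy R /\ 1 < links R (~: R).
  by case/imsetP=> v v3 ->; split; [move: v3; rewrite inE => /eqP/fP[]|apply: big].
have tP : trivIset P.
  apply/trivIsetP=> A B /PP[bA _] /PP[bB _]; apply: contraR; rewrite -setI_eq0 => AB.
  have tI := tset_setI (tight_sparse tG) (base_copy_tset bA) (base_copy_tset bB) AB.
  apply/eqP; rewrite -(base_copy_minimal bA tI (subsetIl _ _)).
  exact: base_copy_minimal bB tI (subsetIr _ _).
(* A tight [R] has degree sum [4 * #|R| - 2] plus the number of its leaving edges, so two leaving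
   edges bring the average up to 4. *)
have cP : \sum_(x in cover P) #|nbr x| >= 4 * #|cover P|.
  rewrite big_trivIset // -(eqnP tP) big_distrr /=; apply: leq_sum => R /PP[/base_copy_tset tR l2].
  have <- : links R R + links R (~: R) = \sum_(x in R) #|nbr x|.
    rewrite -linksU ?setUCr; last by rewrite disjoints_subset setCK.
    by apply: eq_bigr => x _; rewrite setIT.
  by rewrite -double_inner; move: tR l2; rewrite /tset; clear; lia.
have ncP : \sum_(x in ~: cover P) #|nbr x| >= 4 * #|~: cover P|.
  rewrite mulnC -sum_nat_const; apply: leq_sum => x; rewrite inE => xP.
  have := deg3 x; rewrite leq_eqVlt => /orP[/eqP/esym x3|//].
  case/negP: xP; apply/bigcupP; exists (f x); last by case: (fP x x3).
  by apply: imset_f; rewrite inE x3.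
have : \sum_(x in cover P) #|nbr x| + \sum_(x in ~: cover P) #|nbr x| = 2 * #|edges G|.
  rewrite -sum_degree (bigID (mem (cover P)) predT) /=; congr (_ + _).
  by apply: eq_bigl => x; rewrite inE.
have := cardsC (cover P); have := tight_edges tG; move: cP ncP; clear; lia.
Qed.

(** * Inverse moves *)

Section Induced.
Variables (G : sgraph) (A : {set G}).

Definition induced_adj : rel {x : G | x \in A} := fun x y => adj (val x) (val y).

Fact induced_sym : symmetric induced_adj.
Proof. by move=> x y; rewrite /induced_adj adj_sym. Qed.

Fact induced_irr : irreflexive induced_adj.
Proof. by move=> x; rewrite /induced_adj adj_irr. Qed.

Definition induced : sgraph := SGraph induced_sym induced_irr.

Definition vals (X : {set induced}) : {set G} := val @: X.

Lemma card_vals X : #|vals X| = #|X|.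
Proof. exact: card_imset val_inj. Qed.

Lemma vals_neq0 X : X != set0 -> vals X != set0.
Proof. by rewrite -!card_gt0 card_vals. Qed.

Lemma mem_vals X (x : induced) : (val x \in vals X) = (x \in X).
Proof. exact: mem_imset val_inj. Qed.

Lemma vals_sub X : vals X \subset A.
Proof. by apply/subsetP=> x /imsetP[y _ ->]; apply: valP. Qed.

Lemma card_inner_vals X : #|inner (vals X)| = #|inner X|.
Proof. by apply: (@card_inner_imset induced G val) => // x y _ _; apply: val_inj. Qed.

Lemma vals_setT : vals setT = A.
Proof.
apply/setP=> x; apply/imsetP/idP => [[y _ ->]|xA]; first exact: valP.
by exists (Sub x xA).
Qed.

Lemma card_induced : #|induced| = #|A|.
Proof. by rewrite card_sig; apply: eq_card => x; rewrite inE. Qed.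

Lemma card_edges_induced : #|edges induced| = #|inner A|.
Proof. by rewrite -innerT -card_inner_vals vals_setT. Qed.

Lemma tight_induced : tight 1 G -> tset A -> tight 1 induced.
Proof.
move=> tG /eqP tA; apply/tightP; split; last by rewrite card_edges_induced card_induced.
move=> X X0; rewrite -card_inner_vals -card_vals.
by apply: tight_sparse => //; apply: vals_neq0.
Qed.

End Induced.

Lemma iso_refl (G : sgraph) : iso G G.
Proof. by exists id => //; exists id. Qed.

Section RemoveVertex.
Variables (G : sgraph) (v : G).
Let A := [set~ v].

Lemma option_val_bij : bijective (oapp val v : option {x | x \in A} -> G).
Proof.
exists insub => [[a|]|x] /=; first by rewrite valK.
- by rewrite insubN // !inE eqxx.
- by case: insubP => //= /[!inE] /negPn/eqP.
Qed.

Lemma tset_remove2 : tight 1 G -> #|nbr v| = 2 -> tset A.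
Proof.
move=> tG v2; have := card_innerD1 (in_setT v); rewrite setTD setIT innerT v2.
have := tight_edges tG; rewrite /tset /A; have := cardsC1 v.
have : 0 < #|G| by apply/card_gt0P; exists v.
by clear; lia.
Qed.

Lemma inverse_henneberg1 : tight 1 G -> #|nbr v| = 2 ->
  tight 1 (induced A) /\ henneberg1 (induced A) G.
Proof.
move=> tG v2; split; first by apply: tight_induced => //; apply: tset_remove2.
have /eqP/cards2P[a [b [ab Ev]]] := v2.
have vA x : x \in nbr v -> x \in A by rewrite !inE eq_sym; apply: adj_neq.
have aA : a \in A by apply: vA; rewrite Ev set21.
have bA : b \in A by apply: vA; rewrite Ev set22.
exists (Sub a aA), (Sub b bA); split; first by rewrite -val_eqE.
exists (oapp val v); first exact: option_val_bij.
have E (x : induced A) : adj v (val x) = (x \in [set Sub a aA; Sub b bA]).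
  by have /setP/(_ (val x)) := Ev; rewrite !inE -!val_eqE.
move=> [x|] [y|]; [exact: erefl | rewrite /= adj_sym; exact: E | exact: E | exact: adj_irr].
Qed.

End RemoveVertex.

Section AddEdge.
Variables (G : sgraph) (a b : G) (ab : a != b).

Definition add_edge_adj : rel G := fun x y => adj x y || ([set x; y] == [set a; b]).

Fact add_edge_sym : symmetric add_edge_adj.
Proof. by move=> x y; rewrite /add_edge_adj adj_sym setUC. Qed.

Fact add_edge_irr : irreflexive add_edge_adj.
Proof.
move=> x; rewrite /add_edge_adj adj_irr /=; apply: contraNF ab => /eqP/eq_set2P.
by case=> [[<- <-]|[<- <-]].
Qed.

Definition add_edge : sgraph := SGraph add_edge_sym add_edge_irr.

Lemma edges_add_edge : edges add_edge = [set a; b] |: edges G.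
Proof.
apply/setP=> e; rewrite !inE; apply/edgesP/orP => [[x [y [/orP[xy|/eqP xy] ->]]]|].
- by right; rewrite in_edges.
- by left; rewrite xy.
- case=> [/eqP->|/edgesP[x [y [xy ->]]]]; last by exists x, y; rewrite /= /add_edge_adj xy.
  by exists a, b; rewrite /= /add_edge_adj eqxx orbT.
Qed.

Lemma card_inner_add_edge (X : {set G}) :
  #|@inner add_edge X| <= #|inner X| + ((a \in X) && (b \in X)).
Proof.
apply: leq_trans (_ : #|[set e in [set [set a; b]] | e \subset X] :|: inner X| <= _).
  apply: subset_leq_card; apply/subsetP=> e; rewrite !inE edges_add_edge !inE.
  by rewrite andb_orl.
rewrite addnC; apply: leq_trans (leq_card_setU _ _) _; rewrite leq_add2r.
case aX: (a \in X); case bX: (b \in X) => /=; first 1 last.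
1-3: rewrite leqn0 cards_eq0 -subset0; apply/subsetP=> e; rewrite !inE => /andP[/eqP->].
1-3: by rewrite subUset !sub1set aX bX.
by rewrite -(cards1 [set a; b]); apply: subset_leq_card; apply/subsetP=> e; rewrite !inE => /andP[].
Qed.

End AddEdge.

(** Deleting [v] leaves freedom 1 - 2 + 3 = 2, and the edge [a b] brings it back to 1. Sparsity
    could fail only on a tight set that contains [a] and [b] but not [v], which the last hypothesis
    forbids. *)
Lemma inverse_henneberg2 (G : sgraph) (v a b c : G) : tight 1 G ->
  nbr v = [set a; b; c] -> #|nbr v| = 3 -> a != b -> c != a -> c != b -> ~~ adj a b ->
  (forall Y, tset Y -> v \notin Y -> a \in Y -> b \notin Y) ->
  exists G', [/\ tight 1 G', henneberg2 G' G & #|G'| < #|G|].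
Proof.
move=> tG Ev v3 ab ca cb nab unbl; pose A := [set~ v].
have vA x : x \in nbr v -> x \in A by rewrite !inE eq_sym; apply: adj_neq.
have aA : a \in A by apply: vA; rewrite Ev !inE eqxx.
have bA : b \in A by apply: vA; rewrite Ev !inE eqxx ?orbT.
have cA : c \in A by apply: vA; rewrite Ev !inE eqxx ?orbT.
pose a' : induced A := Sub a aA; pose b' : induced A := Sub b bA; pose c' : induced A := Sub c cA.
have ab' : a' != b' by rewrite -val_eqE.
have G0 : 0 < #|G| by apply/card_gt0P; exists v.
have cA1 : #|A|.+1 = #|G| by rewrite cardsC1; move: G0; clear; lia.
exists (add_edge ab'); split.
- apply/tightP; split.
    suff H (X : {set induced A}) : X != set0 -> #|@inner (add_edge ab') X| < 2 * #|X| by exact: H.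
    move=> X0; have := card_inner_add_edge ab' X; rewrite -card_inner_vals -card_vals.
    have := tight_sparse tG (vals_neq0 X0); case: andP => [[aX bX]|_]; last by clear; lia.
    suff : ~~ tset (vals X) by rewrite /tset; clear; lia.
    have aV : a \in vals X by rewrite (mem_vals X a').
    have bV : b \in vals X by rewrite (mem_vals X b').
    have vV : v \notin vals X by apply: contraTN isT => /(subsetP (vals_sub X)); rewrite !inE eqxx.
    by apply: contraTN bV => tX; apply: unbl.
  rewrite -[#|add_edge ab'|]/#|induced A| card_induced.
  have nE : [set a'; b'] \notin edges (induced A) by rewrite in_edges.
  have -> : #|edges (add_edge ab')| = #|inner A|.+1.
    by rewrite edges_add_edge cardsU1 nE card_edges_induced.
  have := card_innerD1 (in_setT v); rewrite setTD setIT innerT v3.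
  by have := tight_edges tG; move: cA1; rewrite /A; clear; lia.
- exists a', b', c'; split=> //=; first by rewrite /add_edge_adj eqxx orbT.
  exists (oapp val v); first exact: option_val_bij.
  have E (x : induced A) : adj v (val x) = (x \in [set a'; b'; c']).
    by have /setP/(_ (val x)) := Ev; rewrite !inE -!val_eqE.
  move=> [x|] [y|]; [|rewrite /= adj_sym; exact: E|exact: E|exact: adj_irr].
  rewrite /= /add_edge_adj /induced_adj /=; case: eqP => [|_]; last by rewrite orbF andbT.
  have nba : adj b a = false by rewrite adj_sym (negbTE nab).
  by rewrite andbF => /eq_set2P[[-> ->]|[-> ->]] /=; rewrite ?(negbTE nab) ?nba.
- by rewrite -[#|add_edge ab'|]/#|induced A| card_induced -cA1.
Qed.


Lemma card3_third (T : finType) (A : {set T}) (a b : T) :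
  #|A| = 3 -> a \in A -> b \in A -> a != b ->
  exists c, [/\ A = [set a; b; c], c != a & c != b].
Proof.
move=> A3 aA bA ab; have /set0Pn[c] : A :\: [set a; b] != set0.
  rewrite -card_gt0; have := cardsID [set a; b] A.
  by rewrite (setIidPr _) ?subUset ?sub1set ?aA ?bA // A3 cards2 ab; clear; lia.
rewrite !inE negb_or => /andP[/andP[ca cb] cA]; exists c; split=> //.
apply/eqP; rewrite eq_sym eqEcard A3 !subUset !sub1set aA bA cA /=.
by rewrite [_ :|: [set c]]setUC cardsU1 cards2 ab !inE negb_or ca cb.
Qed.

(* Two blocked pairs of neighbours would give tight sets whose union, or a tight
   set whose extension by the third neighbour, contains all neighbours of [v]. *)
Lemma henneberg2_or_clique (G : sgraph) (v : G) : tight 1 G -> #|nbr v| = 3 ->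
  (exists G', [/\ tight 1 G', henneberg2 G' G & #|G'| < #|G|]) \/
  {in nbr v &, forall a b, a != b -> adj a b}.
Proof.
move=> tG v3.
pose unblocked (p : G * G) := [&& p.1 \in nbr v, p.2 \in nbr v, p.1 != p.2, ~~ adj p.1 p.2
  & [forall Y : {set G}, [&& tset Y, v \notin Y & p.1 \in Y] ==> (p.2 \notin Y)]].
have [/existsP[[a b] /and5P[/= av bv ab nab /forallP unbl]]|/existsPn blk] :=
  boolP [exists p, unblocked p].
  left; have [c [Ev ca cb]] := card3_third v3 av bv ab.
  apply: (inverse_henneberg2 tG Ev) => // Y tY vY aY.
  by have := unbl Y; rewrite tY vY aY.
right=> a b av bv ab; apply: contraT => nab.
have blocked x y : x \in nbr v -> y \in nbr v -> x != y -> ~~ adj x y ->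
    exists Y, [/\ tset Y, v \notin Y, x \in Y & y \in Y].
  move=> xv yv xy nxy; have := blk (x, y).
  rewrite /unblocked /= xv yv xy nxy /= => /forallPn[Y].
  by rewrite negb_imply negbK => /andP[/and3P[tY vY xY] yY]; exists Y.
have [c [Ev ca cb]] := card3_third v3 av bv ab.
have cv : c \in nbr v by rewrite Ev !inE eqxx !orbT.
have noY Y : tset Y -> v \notin Y -> a \in Y -> b \in Y -> c \in Y -> False.
  move=> tY vY aY bY cY; have := card_nbr_tset (tight_sparse tG) tY vY.
  rewrite (setIidPl _) ?v3 // Ev; apply/subsetP=> x; rewrite !inE.
  by case/orP=> [/orP[]|] /eqP->.
have [Y [tY vY aY bY]] := blocked a b av bv ab nab.
(* For [x] equal to [a] or [b]: if [x] and [c] are not adjacent, this pair is blocked by a tight set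
   meeting [Y] in [x], and the union contains all three neighbours of [v]. *)
have step x y : x \in Y -> ~~ adj x c -> x \in nbr v -> x != c -> y = c -> False.
  move=> xY nxc xv xc _; have [Y' [tY' vY' xY' cY']] := blocked x c xv cv xc nxc.
  apply: (noY (Y :|: Y')); rewrite ?inE ?aY ?bY ?cY' ?negb_or ?vY ?orbT //.
  by apply: tset_setU => //; apply/set0Pn; exists x; rewrite inE xY.
have [ac|/step] := boolP (adj a c); last by case/(_ c); rewrite // eq_sym.
have [bc|/step] := boolP (adj b c); last by case/(_ c); rewrite // eq_sym.
have [cY|cY] := boolP (c \in Y); first by case: (noY Y).
have c2 : #|nbr c :&: Y| = 2.
  apply/eqP; rewrite eqn_leq (card_nbr_tset (tight_sparse tG) tY cY) /=.
  apply: leq_trans (_ : #|[set a; b]| <= _); first by rewrite cards2 ab.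
  by apply: subset_leq_card; rewrite subUset !sub1set !inE ![adj c _]adj_sym ac bc aY.
exfalso; apply: (noY (c |: Y)); rewrite ?inE ?eqxx ?aY ?bY ?orbT //.
- by move: tY; rewrite /tset card_innerU1 // cardsU1 cY c2; clear; lia.
- by rewrite negb_or vY andbT; apply: adj_neq; rewrite inE in cv.
Qed.

Section Contract.
Variables (G : sgraph) (K : {set G}).
Hypothesis K4 : #|K| = 4.
Hypothesis clK : {in K &, forall x y, x != y -> adj x y}.
Hypothesis uK : forall v, v \notin K -> {in K &, forall w w', adj v w -> adj v w' -> w = w'}.

Let C := contract K.

(** Expanding the contracted vertex into [K] adds 3 vertices and 6 edges, so the freedom does not
    change; by [uK] no two edges are identified. *)
Lemma tight_contract : tight 1 G -> tight 1 C.
Proof.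
move=> tG; have [k0 k0K] : exists k, k \in K by apply/card_gt0P; rewrite K4.
(* The value [k0] at the contracted vertex is arbitrary, since images are taken only of sets without
   that vertex. *)
pose h : C -> G := oapp val k0.
have hinj (X : {set C}) : None \notin X -> {in X &, injective h}.
  move=> NX [x|] [y|] //= xX yX.
  - by move/val_inj->.
  - by rewrite yX in NX.
  - by rewrite xX in NX.
have hK (X : {set C}) : None \notin X -> [disjoint h @: X & K].
  move=> NX; rewrite disjoints_subset; apply/subsetP=> x /imsetP[[y|] yX ->].
    by rewrite inE (valP y).
  by rewrite yX in NX.
have hom (X : {set C}) : None \notin X -> {in X &, forall x y, adj (h x) (h y) = adj x y}.
  move=> NX [x|] [y|] //= xX yX.
  - by rewrite yX in NX.
  - by rewrite xX in NX.
  - by rewrite xX in NX.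
have eK : #|inner K| = 6 by have := double_inner_clique clK; rewrite K4; clear; lia.
have eC (X : {set C}) : None \in X -> #|inner X| + 6 = #|inner (h @: (X :\ None) :|: K)|.
  move=> NX; have NX' : None \notin X :\ None by rewrite !inE eqxx.
  rewrite (card_innerD1 NX) card_innerU ?hK // eK -(card_inner_imset (hinj _ NX') (hom _ NX')).
  rewrite addnAC; congr (_ + _); rewrite card_nbrI (big_setD1 None) // adj_irr -[RHS]add0n.
  congr (_ + _).
  rewrite /links big_imset; last exact: hinj.
  apply: eq_bigr => -[[x xK]|]; last by rewrite !inE eqxx.
  move=> _ /=; case: existsP => [[w /andP[wK xw]]|N].
    apply/esym/eqP/cards1P; exists w; apply/setP=> z; rewrite !inE.
    apply/andP/eqP => [[xz zK]|->]; last by rewrite xw wK.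
    exact: (uK xK zK wK).
  apply/esym/eqP; rewrite cards_eq0; apply/eqP/setP=> z; rewrite !inE.
  by apply/negP=> /andP[xz zK]; apply: N; exists z; rewrite zK.
have cC (X : {set C}) : None \in X -> #|h @: (X :\ None) :|: K| = #|X| + 3.
  move=> NX; have NX' : None \notin X :\ None by rewrite !inE eqxx.
  rewrite card_setU_disj ?(card_in_imset (hinj _ NX')) ?K4; last first.
    by apply/eqP; rewrite setI_eq0 hK.
  have -> : #|X| = #|X :\ None|.+1 by rewrite (cardsD1 None X) NX.
  by rewrite addSnnS.
apply/tightP; split=> [X X0|].
  have [NX|NX] := boolP (None \in X).
    have /(tight_sparse tG) : h @: (X :\ None) :|: K != set0.
      by apply/set0Pn; exists k0; rewrite inE k0K orbT.
    by rewrite -eC // cC //; clear; lia.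
  rewrite -(card_inner_imset (hinj _ NX) (hom _ NX)) -(card_in_imset (hinj _ NX)).
  by apply: (tight_sparse tG); rewrite imset_eq0.
have := eC _ (in_setT None); have := cC _ (in_setT None).
have -> : h @: ([set: C] :\ None) :|: K = setT.
  apply/setP=> x; rewrite !inE; have [xK|xK] := boolP (x \in K); first exact: orbT.
  by rewrite orbF; apply/imsetP; exists (Some (Sub x xK)); rewrite ?inE.
by rewrite !innerT !cardsT; have := tight_edges tG; clear; lia.
Qed.

Lemma card_contract : #|C| + 3 = #|G|.
Proof.
rewrite /= card_option; have -> : #|{: {x : G | x \notin K}}| = #|~: K|.
  by rewrite card_sig; apply: eq_card => x; rewrite !inE.
by rewrite -(cardsC K) K4 addSnnS addnC.
Qed.

Lemma inverse_vertex_to_K4 : vertex_to_K4 C G.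
Proof. by exists K; split=> //; apply: iso_refl. Qed.

End Contract.

Section Merge.
Variables (G : sgraph) (v1 v2 : G).
Let A := [set~ v2].

(** The merged vertex keeps the name [v1], and [x != y] drops the loop that the edge [v1 v2] would
    become. *)
Definition merge_adj : rel (induced A) := fun x y =>
  (x != y) && [|| adj (val x) (val y), (val x == v1) && adj v2 (val y)
                 | (val y == v1) && adj v2 (val x)].

Fact merge_sym : symmetric merge_adj.
Proof. by move=> x y; rewrite /merge_adj eq_sym adj_sym; congr (_ && (_ || _)); rewrite orbC. Qed.

Fact merge_irr : irreflexive merge_adj.
Proof. by move=> x; rewrite /merge_adj eqxx. Qed.

Definition merge : sgraph := SGraph merge_sym merge_irr.

Variable u : G.
Hypothesis v12 : adj v1 v2.
Hypothesis uv1 : adj u v1.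
Hypothesis uv2 : adj u v2.
Hypothesis uniq_u : forall w, adj w v1 -> adj w v2 -> w = u.

Let v1A : v1 \in A. Proof. by rewrite !inE adj_neq. Qed.
Let uA : u \in A. Proof. by rewrite !inE adj_neq. Qed.
Let v : merge := (Sub v1 v1A : induced A).
Let u' : merge := (Sub u uA : induced A).

Lemma card_inner_merge0 (X : {set induced A}) : v \notin X ->
  #|@inner merge X| = #|inner (vals X)|.
Proof.
move=> vX; apply/esym; apply: (@card_inner_imset merge G val) => [x y _ _|x y xX yX].
  exact: val_inj.
have nv z : z \in X -> (val z == v1) = false.
  by move=> zX; apply/negP=> /eqP zv; case/negP: vX; rewrite (_ : v = z) //; apply: val_inj.
rewrite /= /merge_adj (nv x xX) (nv y yX) !orbF.
by case: eqP => // ->; rewrite adj_irr.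
Qed.

(** Merging loses the edge [v1 v2], and one more edge when the common neighbour [u] is present,
    because its two edges become one. *)
Lemma card_inner_merge (X : {set induced A}) : v \in X ->
  #|@inner merge X| + (u' \in X).+1 = #|inner (v2 |: vals X)|.
Proof.
move=> vX; set Y := vals (X :\ v).
have vY : v1 \notin Y by rewrite (mem_vals (X :\ v) v) !inE eqxx.
have v2X : v2 \notin vals X by apply/negP=> /(subsetP (vals_sub X)); rewrite !inE eqxx.
have EX : vals X = v1 |: Y by rewrite -{1}(setD1K vX) /vals imsetU1.
rewrite (@card_innerD1 merge v X vX) card_inner_merge0 ?card_innerU1 ?setD11 //.
rewrite -[#|inner (vals _)|]/#|inner Y|.
have -> : @nbr merge v :&: X = [set x : induced A | val x \in (nbr v1 :|: nbr v2) :&: Y].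
  apply/setP=> x; rewrite !inE /= /merge_adj (mem_vals (X :\ v) x) !inE eqxx /= -!andbA.
  rewrite [v == x]eq_sym; case: eqP => //= xv; rewrite ?andbF //.
  suff -> : val x == v1 = false by rewrite orbF.
  by apply/eqP=> E; apply: xv; apply: val_inj.
have -> : #|[set x : induced A | val x \in (nbr v1 :|: nbr v2) :&: Y]|
    = #|(nbr v1 :|: nbr v2) :&: Y|.
  rewrite -card_vals; apply: eq_card => y; apply/imsetP/idP => [[x]|yN].
    by rewrite in_set => ? ->.
  have yA : y \in A by apply: (subsetP (vals_sub (X :\ v))); case/setIP: yN.
  by exists (Sub y yA : induced A); rewrite // in_set.
have -> : nbr v2 :&: vals X = v1 |: (nbr v2 :&: Y).
  rewrite EX setIUr; congr (_ :|: _); apply/setIidPr; rewrite sub1set inE adj_sym //.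
have -> : #|inner (vals X)| = #|inner Y| + #|nbr v1 :&: Y| by rewrite EX card_innerU1.
rewrite cardsU1 !inE (negbTE vY) andbF /= setIUl.
have := cardsUI (nbr v1 :&: Y) (nbr v2 :&: Y).
have -> : #|nbr v1 :&: Y :&: (nbr v2 :&: Y)| = (u' \in X).
  have uY : (u \in Y) = (u' \in X).
    rewrite (mem_vals (X :\ v) u') !inE; suff -> : u' != v by [].
    by rewrite -val_eqE /= (adj_neq uv1).
  case uX: (u' \in X) uY => uY.
    apply/eqP/cards1P; exists u; apply/setP=> z; rewrite !inE; apply/idP/eqP.
      by case/andP=> /andP[zv1 _] /andP[zv2 _]; apply: uniq_u; rewrite adj_sym.
    by move=> ->; rewrite uY ![adj _ u]adj_sym uv1 uv2.
  apply/eqP; rewrite cards_eq0; apply/eqP/setP=> z; rewrite !inE; apply/negP.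
  case/andP=> /andP[zv1 zY] /andP[zv2 _]; move: uY.
  by rewrite -(@uniq_u z) ?zY // adj_sym.
by move=> E; rewrite addnS -addnA E add1n addnS addnA.
Qed.

(** One vertex and two edges disappear from a set containing [u], which keeps its freedom. Without
    [u] only one edge disappears and the freedom falls by 1, but by hypothesis it was at least 2. *)
Lemma tight_merge : tight 1 G ->
  (forall Y, tset Y -> v1 \in Y -> v2 \in Y -> u \in Y) -> tight 1 merge.
Proof.
move=> tG nY; have cU (X : {set induced A}) : #|v2 |: vals X| = #|X|.+1.
  rewrite cardsU1 card_vals; suff -> : v2 \notin vals X by [].
  by apply/negP=> /(subsetP (vals_sub X)); rewrite !inE eqxx.
apply/tightP; split.
  suff H (X : {set induced A}) : X != set0 -> #|@inner merge X| < 2 * #|X| by exact: H.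
  move=> X0; have [vX|vX] := boolP (v \in X); last first.
    by rewrite card_inner_merge0 // -card_vals; apply: tight_sparse => //; apply: vals_neq0.
  have /(tight_sparse tG) : v2 |: vals X != set0 by apply/set0Pn; exists v2; rewrite setU11.
  have := card_inner_merge vX; rewrite cU; case uX: (u' \in X); first by clear; lia.
  suff : ~~ tset (v2 |: vals X) by rewrite /tset cU; clear; lia.
  apply/negP=> /nY; rewrite !inE eqxx (mem_vals X v) vX (mem_vals X u') uX orbT orbF.
  by move/(_ isT isT)/eqP=> E; move: uv2; rewrite E adj_irr.
have EA : v2 |: vals [set: induced A] = setT by rewrite vals_setT setUCr.
have E : #|edges merge| + 2 = #|edges G|.
  by rewrite -[edges G]innerT -EA -(card_inner_merge (in_setT v)) in_setT innerT.
rewrite -[#|merge|]/#|induced A|; have := tight_edges tG; have := cU setT.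
by rewrite EA !cardsT; move: E; clear; lia.
Qed.

Lemma card_merge : #|merge| < #|G|.
Proof.
rewrite -[#|merge|]/#|induced A| card_induced cardsC1.
by have : 0 < #|G| by [apply/card_gt0P; exists u]; clear; lia.
Qed.

Lemma inverse_edge_to_K3 : edge_to_K3 merge G.
Proof.
have [v1n v2n] := (adj_neq v12, adj_neq uv2).
(* Adjacency to [v1] is a valid bipartition: a neighbour of the merged vertex other than [u] is
   adjacent to exactly one of [v1] and [v2]. *)
exists u', v, (fun x : merge => adj (val (x : induced A)) v1); split.
  by rewrite /= /merge_adj -val_eqE /= (adj_neq uv1) uv1.
pose h (x : ({x : merge | x != v} + bool)%type) : G :=
  match x with inl x => val (val x : induced A) | inr true => v1 | inr false => v2 end.
have nv1 (a : {x : merge | x != v}) : (val (val a : induced A) == v1) = false.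
  apply/negP=> /eqP E; have := valP a; case/negP; apply/eqP; exact: val_inj.
have nv2 (a : {x : merge | x != v}) : (val (val a : induced A) == v2) = false.
  by have := valP (val a : induced A); rewrite !inE => /negbTE.
exists h.
  apply: inj_card_bij; last first.
    have E1 : #|{: {x : merge | x != v}}| = #|merge|.-1.
      by rewrite card_sig -(cardC1 v); apply: eq_card => x; rewrite !inE.
    have E2 : #|merge| = #|G|.-1 by rewrite -[#|merge|]/#|induced A| card_induced cardsC1.
    rewrite card_sum card_bool; move: E1; rewrite E2 => ->.
    by case: #|G| => [|[|n]] //; rewrite addn2.
  move=> [a|[]] [b|[]] //= E.
  - by congr inl; apply: val_inj; apply: val_inj.
  - by have := nv1 a; rewrite [X in X == _]E eqxx.
  - by have := nv2 a; rewrite [X in X == _]E eqxx.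
  - by have := nv1 b; rewrite -[X in X == _]E eqxx.
  - by move: v1n; rewrite E eqxx.
  - by have := nv2 b; rewrite -[X in X == _]E eqxx.
  - by move: v1n; rewrite E eqxx.
have key (a : {x : merge | x != v}) i : adj (h (inl a)) (h (inr i)) = 
   (val a == u') || @adj merge (val a) v && (adj (val (val a : induced A)) v1 == i).
  have -> : @adj merge (val a) v =
      adj (val (val a : induced A)) v1 || adj v2 (val (val a : induced A)).
    by rewrite /= /merge_adj -val_eqE /= nv1 eqxx.
  have [E|au] := eqVneq (val a) u'.
    have -> : h (inl a) = u by rewrite /= E.
    by case: i => /=; rewrite ?uv1 ?uv2.
  have: ~~ (adj (val (val a : induced A)) v1 && adj (val (val a : induced A)) v2).
    by apply: contra au => /andP[a1 a2]; apply/eqP; apply: val_inj; apply: uniq_u.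
  rewrite [adj v2 _]adj_sym /=; case: i => /=; by do 2!case: adj.
move=> [a|i] [b|j].
- by rewrite /= /merge_adj !nv1 !orbF; case: eqP => // ->; rewrite adj_irr.
- exact: key.
- by rewrite adj_sym; apply: key.
- by case: i; case: j => /=; rewrite ?adj_irr // adj_sym.
Qed.

End Merge.


(** * From tight graphs to derivations *)

Lemma copy_setT_iso (B G : sgraph) (R : {set G}) : copy B R -> R = setT -> iso B G.
Proof.
case=> h [inj hom ER] RT; exists h => //.
by apply: inj_card_bij => //; rewrite -cardsT -RT ER card_imset // cardsT.
Qed.

(** The freedom of the whole is that of [R] plus that of [~: R] minus the number of links. As the
    first two are 1, the complement has freedom equal to the number of links, which is at least 1 by
    sparsity and at most 1 by hypothesis. *)
Lemma inverse_edge_joining (G : sgraph) (R : {set G}) : tight 1 G -> tset R ->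
  R != setT -> links R (~: R) <= 1 ->
  tset (~: R) /\ edge_joining (induced R) (induced (~: R)) G.
Proof.
move=> tG tR RT l1.
have dR : [disjoint R & ~: R] by rewrite disjoints_subset setCK.
have N0 : ~: R != set0 by apply: contraNneq RT => E; rewrite -[R]setCK E setC0.
have := card_innerU dR; rewrite setUCr innerT => eT.
have [tRC lE] : tset (~: R) /\ links R (~: R) = 1.
  have := tight_sparse tG N0; have := tight_edges tG; have := cardsC R.
  by move: tR l1 eT; rewrite /tset; clear; lia.
have [u uR lu] : exists2 u, u \in R & 0 < #|nbr u :&: ~: R|.
  apply/exists_inP; apply: contraT => /exists_inPn H; move: lE.
  by rewrite /links big1 // => x /H; rewrite -leqNgt leqn0 => /eqP.
move: (lE); rewrite /links (big_setD1 u) //= => lS.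
have /eqP/cards1P[w Ew] : #|nbr u :&: ~: R| = 1 by move: lS lu; clear; lia.
have rest x y : x \in R -> y \notin R -> adj x y = (x == u) && (y == w).
  move=> xR yR; have [->|xu] /= := eqVneq x u.
    by have /setP/(_ y) := Ew; rewrite !inE yR andbT.
  apply/negbTE/negP=> xy.
  have : \sum_(i in R :\ u) #|nbr i :&: ~: R| = 0 by move: lS; rewrite Ew cards1; clear; lia.
  move/eqP; rewrite sum_nat_eq0 => /forall_inP/(_ x); rewrite !inE xu xR => /(_ isT).
  by rewrite cards_eq0 => /eqP/setP/(_ y); rewrite !inE xy yR.
have /setIP[_ wR] : w \in nbr u :&: ~: R by rewrite Ew set11.
split=> //; split; [exact: tight_induced|exact: tight_induced|].
exists (Sub u uR), (Sub w wR).
pose h (x : (induced R + induced (~: R))%type) : G :=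
  match x with inl x => val x | inr x => val x end.
have inR (a : induced R) : val a \in R := valP a.
have inC (a : induced (~: R)) : val a \notin R by have := valP a; rewrite inE.
exists h.
  apply: inj_card_bij; last by rewrite card_sum !card_induced cardsC.
  move=> [a|a] [b|b] /= E.
  - by congr inl; apply: val_inj.
  - by have := inC b; rewrite -[val b]E inR.
  - by have := inC a; rewrite [val a]E inR.
  - by congr inr; apply: val_inj.
move=> [a|a] [b|b]; first exact: erefl.
- exact: (rest _ _ (inR a) (inC b)).
- by rewrite adj_sym; apply: (rest _ _ (inR b) (inC a)).
- exact: erefl.
Qed.

(** Removing a vertex of degree d leaves freedom d - 1, which sparsity bounds below by 1. *)
Lemma degree_ge2 (G : sgraph) (v : G) : tight 1 G -> 1 < #|nbr v|.
Proof.
move=> tG; have := card_innerD1 (in_setT v); rewrite setTD setIT innerT.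
have c5 : 4 < #|[set: G]| by apply: tset_ge5; rewrite /tset innerT cardsT tight_edges.
have A0 : [set~ v] != set0 by rewrite -card_gt0 cardsC1; move: c5; rewrite cardsT; clear; lia.
have := tight_sparse tG A0; have := tight_edges tG; rewrite cardsC1.
by move: c5; rewrite cardsT; clear; lia.
Qed.

Lemma tight_derivable (G : sgraph) : tight 1 G -> derivable G.
Proof.
have [n] := ubnP #|G|; elim: n G => // n IH G nG tG.
have IH' (G' : sgraph) : tight 1 G' -> #|G'| < #|G| -> derivable G'.
  by move=> tG' lt; apply: IH => //; apply: leq_trans lt _; rewrite -ltnS.
have [/existsP[v /eqP v2]|no2] := boolP [exists v : G, #|nbr v| == 2].
  have [tG' mv] := inverse_henneberg1 tG v2.
  apply: Derivable_henneberg1 mv; apply: IH' => //.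
  by rewrite card_induced cardsC1 ltn_predL; apply/card_gt0P; exists v.
have deg3 (v : G) : 2 < #|nbr v|.
  have := degree_ge2 v tG; rewrite leq_eqVlt => /orP[/eqP E|//].
  by case/existsP: no2; exists v; rewrite -E.
(* These are the conditions under which the edge [x p] can be contracted, with [q] as the third
   vertex of the triangle. *)
have [/existsP[x /existsP[p /existsP[q]]]|no3] := boolP [exists x : G, [exists p, [exists q,
    [&& adj x p, adj x q, adj p q, [forall w, (adj w x && adj w p) ==> (w == q)]
      & [forall Y : {set G}, [&& tset Y, x \in Y & p \in Y] ==> (q \in Y)]]]]].
  case/and5P=> xp xq pq /forallP Hw /forallP HY.
  have uw w : adj w x -> adj w p -> w = q.
    by move=> wx wp; have := Hw w; rewrite wx wp => /eqP.
  have qx : adj q x by rewrite adj_sym.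
  have qp : adj q p by rewrite adj_sym.
  apply: Derivable_edge_to_K3 (inverse_edge_to_K3 xp qx qp uw).
  apply: IH'; last exact: card_merge.
  apply: (tight_merge xp qx qp uw) => // Y tY xY pY.
  by have := HY Y; rewrite tY xY pY.
have noK3 : forall x p q, adj x p -> adj x q -> adj p q ->
  (exists w, [/\ w != q, adj w x & adj w p]) \/
  (exists Y : {set G}, [/\ tset Y, x \in Y, p \in Y & q \notin Y]).
  move=> x p q xp xq pq; move: no3 => /existsPn/(_ x)/existsPn/(_ p)/existsPn/(_ q).
  rewrite xp xq pq /= negb_and => /orP[/forallPn[w]|/forallPn[Y]]; rewrite negb_imply.
    by case/andP=> /andP[wx wp] wq; left; exists w.
  by case/andP=> /and3P[tY xY pY] qY; right; exists Y.
suff [//|H] : derivable G \/ forall v : G, #|nbr v| = 3 -> exists2 R, base_copy R & v \in R.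
  have [R bR l1] := few_links tG deg3 H.
  have [RT|RT] := eqVneq R setT.
    by case: bR => /copy_setT_iso/(_ RT); [exact: Derivable_K5e|exact: Derivable_K4K4].
  have tR := base_copy_tset bR.
  have [tC ej] := inverse_edge_joining tG tR RT l1.
  have R0 := tset_nonempty tR; have C0 := tset_nonempty tC.
  apply: (Derivable_edge_joining _ _ ej); apply: IH'; try exact: tight_induced.
    by rewrite card_induced -(cardsC R) -[X in X < _]addn0 ltn_add2l card_gt0.
  by rewrite card_induced -(cardsC R) -[X in X < _]add0n ltn_add2r card_gt0.
(* [derivable] is not decidable, so finite choice records for each vertex, by a boolean, which
   alternative was established there. *)
suff /fin_all_exists[f fP] : forall v : G, exists b : bool,
    if b then #|nbr v| = 3 -> exists2 R, base_copy R & v \in R else derivable G.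
  have [/forallP fT|/forallPn[v]] := boolP [forall v, f v]; last first.
    by have := fP v; case: (f v) => // dG; left.
  by right=> v; have := fP v; rewrite fT.
move=> v; have [v3|v3] := eqVneq #|nbr v| 3; last by exists true => E; rewrite E in v3.
have [[G' [tG' mv lt]]|cl] := henneberg2_or_clique tG v3.
  by exists false; apply: Derivable_henneberg2 mv; apply: IH'.
pose K := v |: nbr v.
have K4 : #|K| = 4 by rewrite cardsU1 inE adj_irr v3.
have clK : {in K &, forall x y, x != y -> adj x y}.
  move=> x y; rewrite !inE => /orP[/eqP->|vx] /orP[/eqP->|vy] //; rewrite ?eqxx //.
    by rewrite adj_sym.
  by apply: cl; rewrite inE.
have [/existsP[x /andP[xK]]|none] := boolP [exists x, (x \notin K) && (1 < #|nbr x :&: K|)].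
  case/card_gt1P=> a [b [/setIP[xa aK] /setIP[xb bK] ab]].
  move: xK; rewrite !inE negb_or => /andP[xv nxv].
  have inN y : y \in K -> y \in nbr x -> y \in nbr v.
    by rewrite !inE => /orP[/eqP->|//] xv'; rewrite adj_sym xv' in nxv.
  have av := inN a aK xa; have bv := inN b bK xb.
  have [c [Ev ca cb]] := card3_third v3 av bv ab.
  have cv : c \in nbr v by rewrite Ev !inE eqxx !orbT.
  exists true => _; rewrite !inE in xa xb.
  apply: (base_copy_at (tight_sparse tG) noK3 Ev _ _ _ xv _ xa xb); rewrite ?inE //.
  - exact: cl.
  - by apply: cl; rewrite // eq_sym.
  - by apply: cl; rewrite // eq_sym.
have uK : forall x, x \notin K -> {in K &, forall w w', adj x w -> adj x w' -> w = w'}.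
  move=> x xK w w' wK w'K xw xw'; apply/eqP; apply: contraT => ww'.
  case/existsP: none; exists x; rewrite xK; apply/card_gt1P; exists w, w'.
  by split=> //; apply/setIP; split=> //; rewrite inE.
exists false; apply: Derivable_vertex_to_K4 (inverse_vertex_to_K4 K4 clK uK).
by apply: IH'; [exact: tight_contract|rewrite -(card_contract K4) addn3 ltnS -addn2 leq_addr].
Qed.


(** * Orientations *)

Definition arcs (T : eqType) (s : T -> option T) (x y : T) : nat :=
  (s x == Some y) + (s y == Some x).

(** Absence of directed cycles, stated in the form in which the edge count uses it. *)
Definition grounded (T : finType) (s : T -> option T) := forall X : {set T},
  X != set0 -> exists2 x, x \in X & forall y, s x = Some y -> y \notin X.

(** With [o = None] this says that [s] is total, so one predicate serves both classes of arcs. *)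
Definition rooted (T : eqType) (s : T -> option T) (o : option T) :=
  forall x, (s x == None) = (o == Some x).

(* The tree is recorded by its parent function [t], the unicyclic part by a
   choice [p] of one outgoing edge at each vertex; the equation on [adj] says
   that every edge is used once. *)
Definition oriented (G : sgraph) := exists (t p : G -> option G) (r : G),
  [/\ forall x y, arcs t x y + arcs p x y = adj x y, grounded t,
      rooted t (Some r) & rooted p None].

Lemma arcsC (T : eqType) (s : T -> option T) x y : arcs s x y = arcs s y x.
Proof. exact: addnC. Qed.

Lemma grounded_depth (T : finType) (s : T -> option T) (d : T -> nat) :
  (forall x y, s x = Some y -> d y < d x) -> grounded s.
Proof.
move=> dP X /set0Pn[x0 x0X]; case: (arg_minnP d x0X) => x xX dmin; exists x => // y /dP.
by rewrite ltnNge; apply: contra => /dmin.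
Qed.

Lemma oriented_iso (G H : sgraph) : iso G H -> oriented G -> oriented H.
Proof.
case=> h [g hK gK] hom [t [p [r [E gt rt rp]]]].
pose f (s : G -> option G) y := omap h (s (g y)).
have fE s x y : (f s x == Some y) = (s (g x) == Some (g y)).
  rewrite /f; case: (s (g x)) => [z|] //=.
  by apply/eqP/eqP => [[<-]|[->]]; rewrite ?hK ?gK.
have fN s x : (f s x == None) = (s (g x) == None) by rewrite /f; case: (s (g x)).
exists (f t), (f p), (h r); split=> [x y|X X0|x|x].
- by have := hom (g x) (g y); rewrite /arcs !fE !gK => ->; rewrite -E.
- have [|x] := gt (g @: X); first by rewrite imset_eq0.
  case/imsetP=> y yX -> sy; exists y => // z /eqP; rewrite fE => /eqP/sy.
  by apply: contra => zX; apply: imset_f.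
- by rewrite fN rt; apply/eqP/eqP => [[->]|[<-]]; rewrite ?hK ?gK.
- by rewrite fN rp.
Qed.

Section Henneberg1.
Variables (G : sgraph).

Definition attach (w : G) (s : G -> option G) (x : option G) : option (option G) :=
  if x is Some a then omap Some (s a) else Some (Some w).

Lemma attach_arcs w s a b : arcs (attach w s) (Some a) (Some b) = arcs s a b.
Proof. by rewrite /arcs /=; case: (s a); case: (s b). Qed.

Lemma attach_arcsN w s a : arcs (attach w s) (Some a) None = (w == a).
Proof. by rewrite /arcs /=; case: (s a). Qed.

Lemma attach_rooted w s o : rooted s o -> rooted (attach w s) (omap Some o).
Proof. by move=> rs [x|] /=; [have := rs x|]; case: o {rs} => //=; case: (s x). Qed.

Lemma attach_grounded w s : grounded s -> grounded (attach w s).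
Proof.
move=> gs X X0; pose Y := [set a | Some a \in X].
have [Y0|/gs[a]] := eqVneq Y set0.
  have NY a : Some a \notin X by have /setP/(_ a) := Y0; rewrite !inE => ->.
  have [[a|] xX] := set0Pn _ X0; first by rewrite (negbTE (NY a)) in xX.
  by exists None => // y [<-].
rewrite inE => aX H; exists (Some a) => // -[b|] /=; case sa: (s a) => [c|] //= [<-].
by have := H c sa; rewrite inE.
Qed.

Lemma oriented_H1 (u v : G) : u != v -> oriented G -> oriented (H1_graph u v).
Proof.
move=> uv [t [p [r [E gt rt rp]]]]; exists (attach u t), (attach v p), (Some r).
have Ea a : arcs (attach u t) (Some a) None + arcs (attach v p) (Some a) None = (a \in [set u; v]).
  rewrite !attach_arcsN !inE ![_ == a]eq_sym; case: (eqVneq a u) => [->|] //=.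
  by rewrite (negbTE uv).
split.
- move=> [a|] [b|]; last by [].
  + by rewrite !attach_arcs E.
  + exact: Ea.
  + by rewrite ![arcs _ None _]arcsC; apply: Ea.
- exact: attach_grounded.
- exact: (attach_rooted u rt).
- exact: (attach_rooted v rp).
Qed.

Variables (u v w : G).

(** The class that contains the edge [u v] is routed through the new vertex in the same direction;
    the other class gains the arc from the new vertex to [w]. *)
Definition subdivide (s : G -> option G) (x : option G) : option (option G) :=
  if x is Some a then
    if (s a == Some v) && (a == u) || (s a == Some u) && (a == v) then Some None
    else omap Some (s a)
  else Some (Some (if s u == Some v then v else if s v == Some u then u else w)).

Hypothesis uv : u != v.

Lemma subdivide_arcs s a b : arcs (subdivide s) (Some a) (Some b) = 
  arcs s a b * ([set a; b] != [set u; v]).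
Proof.
have fE x y : (subdivide s (Some x) == Some (Some y)) =
    (s x == Some y) && ([set x; y] != [set u; v]).
  rewrite /=; case sx: (s x) => [z|] //=.
  have E : (Some z == Some v) && (x == u) || (Some z == Some u) && (x == v) =
      ([set x; z] == [set u; v]).
    apply/orP/eqP => [[/andP[/eqP[->] /eqP->]|/andP[/eqP[->] /eqP->]]|
      /eq_set2P[[-> ->]|[-> ->]]] //.
    - by rewrite setUC.
    - by left; rewrite !eqxx.
    - by right; rewrite !eqxx.
  have -> : (Some z == Some y) = (z == y) by [].
  case: (eqVneq z y) => [<-|zy] /=; rewrite E; case: ([set x; z] == _) => //=.
    by rewrite eqxx.
  by apply/negbTE; apply: contra zy => /eqP[->].
rewrite /arcs !fE (setUC [set b] [set a]); case: ([set a; b] != _).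
  by rewrite !andbT muln1.
by rewrite !andbF muln0.
Qed.

Lemma subdivide_arcsN s a : w != u -> w != v -> arcs s u v <= 1 ->
  arcs (subdivide s) (Some a) None = if arcs s u v == 1 then a \in [set u; v] else w == a.
Proof.
move=> wu wv; rewrite /arcs /= !inE.
have oN (o : option G) : (omap Some o == Some None) = false by case: o.
have SS (x y : G) : (Some (Some x) == Some (Some y)) = (x == y) by [].
have vu : (v == u) = false by rewrite eq_sym (negbTE uv).
case: (eqVneq a u) => [->|au].
  rewrite (negbTE uv) andbT andbF orbF.
  by case: (s u == Some v); case: (s v == Some u) => //= _;
    rewrite ?oN SS ?eqxx ?vu ?(negbTE wu).
case: (eqVneq a v) => [->|av].
  rewrite andbT andbF /=.
  by case: (s u == Some v); case: (s v == Some u) => //= _;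
    rewrite ?oN SS ?eqxx ?(negbTE uv) ?(negbTE wv).
rewrite !andbF /= oN.
by case: (s u == Some v); case: (s v == Some u) => //= _;
  rewrite SS ?[_ == a]eq_sym ?(negbTE au) ?(negbTE av).
Qed.

Lemma subdivide_rooted s o : rooted s o -> rooted (subdivide s) (omap Some o).
Proof.
move=> rs [x|] /=; last by case: o {rs}.
by have := rs x; case: ifP => [|_]; case: o {rs} => //=; case: (s x).
Qed.

Lemma subdivide_grounded s : arcs s u v <= 1 -> grounded s -> grounded (subdivide s).
Proof.
move=> s1 gs X X0; pose Y := [set a | Some a \in X].
have [Y0|/gs[a]] := eqVneq Y set0.
  have NY a : Some a \notin X by have /setP/(_ a) := Y0; rewrite !inE => ->.
  have [[a|] xX] := set0Pn _ X0; first by rewrite (negbTE (NY a)) in xX.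
  by exists None => // y [<-].
rewrite inE => aX H.
case cond : ((s a == Some v) && (a == u) || (s a == Some u) && (a == v)); last first.
  exists (Some a) => // y /=; rewrite cond; case sa: (s a) => [c|] //= [<-].
  by have := H c sa; rewrite inE.
(* If the arc of [a] now ends in [None] and [None] is in [X], then [None] is the witness: its arc
   ends where that of [a] used to, outside [X]. *)
have [NX|NX] := boolP (None \in X); last by exists (Some a) => // y /=; rewrite cond => -[<-].
exists None => // y /= [<-].
case/orP: cond => /andP[/eqP sa /eqP E]; subst a; rewrite sa eqxx.
  by have := H _ sa; rewrite inE.
case: eqP => [su|_]; last by have := H _ sa; rewrite inE.
by move: s1; rewrite /arcs su sa !eqxx.
Qed.

Lemma oriented_H2 : adj u v -> w != u -> w != v -> oriented G -> oriented (H2_graph u v w).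
Proof.
move=> auv wu wv [t [p [r [E gt rt rp]]]]; have Euv := E u v; rewrite auv in Euv.
have t1 : arcs t u v <= 1 by move: Euv; clear; lia.
have p1 : arcs p u v <= 1 by move: Euv; clear; lia.
have Ea a : arcs (subdivide t) (Some a) None + arcs (subdivide p) (Some a) None =
    (a \in [set u; v; w]).
  have pt : (arcs p u v == 1) = ~~ (arcs t u v == 1) by move: Euv; clear; lia.
  rewrite !subdivide_arcsN // pt !inE [w == a]eq_sym; case: (arcs t u v == 1) => /=;
    case: (eqVneq a u) => [->|_] /=; rewrite ?[u == w]eq_sym ?(negbTE wu) //;
    by case: (eqVneq a v) => [->|_] /=; rewrite ?[v == w]eq_sym ?(negbTE wv) //; case: (a == w).
exists (subdivide t), (subdivide p), (Some r); split.
- move=> [a|] [b|]; last by [].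
  + by rewrite !subdivide_arcs -mulnDl E mulnb.
  + exact: Ea.
  + by rewrite ![arcs _ None _]arcsC; apply: Ea.
- exact: subdivide_grounded.
- exact: (subdivide_rooted rt).
- exact: (subdivide_rooted rp).
Qed.

End Henneberg1.


Section SplitVertex.
Variables (G : sgraph) (u v : G) (side : G -> bool).
Hypothesis uv : u != v.

Local Notation V' := ({x : G | x != v} + bool)%type.

Definition collapse (x : V') : G := if x is inl a then val a else v.

Definition target (y : G) : V' := if insub y is Some a then inl a else inr true.

(* The end of the split vertex that inherits its outgoing arc. *)
Definition exit_side (s : G -> option G) : bool := oapp side true (s v).

(** The class that contains the edge [u v] receives both edges from [u] to the new vertices, and the
    other class receives the edge between these. *)
Definition split_vertex (s : G -> option G) (x : V') : option V' :=
  match x with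
  | inl a => omap (fun y => if y == v then
      inr (if val a == u then exit_side s else side (val a)) else target y) (s (val a))
  | inr i => if s v == Some u then Some (target u)
             else if i == exit_side s then omap target (s v)
             else Some (if s u == Some v then target u else inr (exit_side s))
  end.

Lemma target_inl y (b : {x : G | x != v}) : (target y == inl b) = (y == val b).
Proof.
rewrite /target; case: insubP => [c _ <-|]; first by rewrite val_eqE.
by rewrite negbK => /eqP->; apply/esym/negbTE; rewrite eq_sym (valP b).
Qed.

Lemma target_inr y i : y != v -> (target y == inr i) = false.
Proof. by move=> yv; rewrite /target insubT. Qed.

Lemma collapse_target y : collapse (target y) = y.
Proof. by rewrite /target; case: insubP => [c _ <-|] //=; rewrite negbK => /eqP. Qed.

Let Some_eq (T : eqType) (x y : T) : (Some x == Some y) = (x == y). Proof. by []. Qed.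

Lemma split_ll s a b : (split_vertex s (inl a) == Some (inl b)) = (s (val a) == Some (val b)).
Proof.
rewrite /=; case: (s (val a)) => [y|] //=; rewrite !Some_eq.
case: (eqVneq y v) => [->|_]; last exact: target_inl.
by apply/esym/negbTE; rewrite eq_sym (valP b).
Qed.

Lemma split_lr s a i : (split_vertex s (inl a) == Some (inr i)) =
  (s (val a) == Some v) && ((if val a == u then exit_side s else side (val a)) == i).
Proof.
rewrite /=; case: (s (val a)) => [y|] //=; rewrite !Some_eq.
by case: (eqVneq y v) => [_|yv] //; rewrite target_inr.
Qed.

Lemma split_rl s i b : (split_vertex s (inr i) == Some (inl b)) =
  if s v == Some u then u == val b else
  if i == exit_side s then s v == Some (val b) else (s u == Some v) && (u == val b).
Proof.
rewrite /=; case: ifP => _; first exact: target_inl.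
case: ifP => _; last by case: ifP => _ //; apply: target_inl.
by case: (s v) => [y|] //=; apply: target_inl.
Qed.

Lemma split_rr s i j : s v != Some v -> (split_vertex s (inr i) == Some (inr j)) =
  [&& s v != Some u, i != exit_side s, s u != Some v & j == exit_side s].
Proof.
move=> sv; rewrite /=; case: (s v == Some u); first by rewrite /= Some_eq target_inr.
case: (i == _) => /=.
  by case E: (s v) sv => [y|] //=; rewrite !Some_eq => /target_inr.
by case: (s u == Some v); rewrite Some_eq ?target_inr // eq_sym.
Qed.

Lemma split_arcs_l s a b : arcs (split_vertex s) (inl a) (inl b) = arcs s (val a) (val b).
Proof. by rewrite /arcs !split_ll. Qed.

Lemma split_arcs_lr s a i : val a != u ->
  arcs (split_vertex s) (inl a) (inr i) = arcs s (val a) v * (side (val a) == i).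
Proof.
move=> au; rewrite /arcs split_lr split_rl (negbTE au) mulnDl -mulnb; congr (_ + _).
rewrite [u == _]eq_sym (negbTE au) andbF; case: eqP => [->|_].
  by rewrite Some_eq [u == _]eq_sym (negbTE au).
rewrite /exit_side; case: (s v) => [y|] /=; last by case: ifP.
by rewrite Some_eq [i == _]eq_sym; case: (eqVneq y (val a)) => [->|_]; case: (_ == i).
Qed.

Lemma split_arcs_ur s a i : val a = u -> arcs s u v <= 1 ->
  arcs (split_vertex s) (inl a) (inr i) = arcs s u v.
Proof.
move=> au; rewrite /arcs split_lr split_rl au !eqxx [i == _]eq_sym andbT.
by case: (s v == Some u); case: (s u == Some v); case: (_ == i).
Qed.

Lemma split_arcs_r s i j : s v != Some v -> arcs s u v <= 1 ->
  arcs (split_vertex s) (inr i) (inr j) = (i != j) * (arcs s u v == 0).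
Proof.
move=> sv; rewrite /arcs !split_rr //; case: (s v == Some u); case: (s u == Some v) => //= _;
  by rewrite ?andbF; case: i; case: j; case: exit_side.
Qed.

Lemma split_rooted s o : rooted s o ->
  rooted (split_vertex s) (omap (fun r => if r == v then inr (exit_side s) else target r) o).
Proof.
move=> rs [a|i].
  have -> : (split_vertex s (inl a) == None) = (s (val a) == None) by rewrite /=; case: (s _).
  rewrite rs; case: o {rs} => [r|] //=; rewrite !Some_eq; case: (eqVneq r v) => [->|_].
    by apply/negbTE; rewrite eq_sym (valP a).
  by rewrite target_inl.
have := rs v; rewrite /=; case E: (s v) => [y|] /=.
  have -> : (if Some y == Some u then Some (target u) else if i == exit_side s then Some (target y)
    else Some (if s u == Some v then target u else inr (exit_side s))) == None = false.
    by case: ifP => // _; case: ifP.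
  case: o {rs} => [r|] //=; rewrite !Some_eq; case: (eqVneq r v) => [_|rv _] //.
  by rewrite target_inr.
case: o {rs} => [r|] //=; rewrite !Some_eq => /esym/eqP->; rewrite eqxx [inr _ == _]eq_sym.
have -> : (inr i == inr (exit_side s) :> V') = (i == exit_side s) by [].
by case: ifP.
Qed.

Lemma split_grounded s : grounded s -> grounded (split_vertex s).
Proof.
move=> gs X X0; have [|_ /imsetP[x xX ->] H] := gs (collapse @: X); first by rewrite imset_eq0.
have out y z : s (collapse x) = Some y -> collapse z = y -> z \notin X.
  by move=> sx zy; have := H y sx; rewrite -zy; apply: contra => zX; apply: imset_f.
case: x xX {H} out => [a|i] xX out.
  exists (inl a) => // z /=; rewrite /= in out.
  case E: (s (val a)) => [y|] //= [<-]; apply: (out y) => //.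
  by case: (eqVneq y v) => [->|_] //; rewrite collapse_target.
rewrite /= in out; have [su|su] := eqVneq (s v) (Some u).
  exists (inr i) => // z /=; rewrite su eqxx => -[<-].
  by apply: (out u); rewrite // collapse_target.
(* The exit end is a witness if it is in [X]. Otherwise the other end is one, unless its arc goes to
   [u] and [u] is in [X]; in that case the arc of [u] goes to the exit end and leaves [X]. *)
have [eX|eX] := boolP (inr (exit_side s) \in X).
  exists (inr (exit_side s)) => // z /=; rewrite (negbTE su) eqxx.
  case E: (s v) => [y|] //= [<-].
  by apply: (out y); rewrite // collapse_target.
have ie : (i == exit_side s) = false by apply/negP=> /eqP E; rewrite -E xX in eX.
have [usv|usv] := eqVneq (s u) (Some v); last first.
  by exists (inr i) => // z /=; rewrite (negbTE su) ie (negbTE usv) => -[<-].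
have [uX|uX] := boolP (target u \in X); last first.
  by exists (inr i) => // z /=; rewrite (negbTE su) ie usv eqxx => -[<-].
exists (target u) => //; rewrite /target insubT /= => z.
by rewrite usv /= !eqxx => -[<-].
Qed.

End SplitVertex.

Lemma oriented_K3 (G : sgraph) (u v : G) (side : G -> bool) : adj u v ->
  oriented G -> oriented (K3_graph u v side).
Proof.
move=> auv [t [p [r [E gt rt rp]]]]; have Euv := E u v; rewrite auv in Euv.
have uv := adj_neq auv.
have t1 : arcs t u v <= 1 by move: Euv; clear; lia.
have p1 : arcs p u v <= 1 by move: Euv; clear; lia.
have noloop : t v != Some v /\ p v != Some v.
  by have := E v v; rewrite adj_irr /arcs; case: (t v == _); case: (p v == _).
exists (split_vertex u side t), (split_vertex u side p); eexists; split.
- have lr a i : arcs (split_vertex u side t) (inl a) (inr i) +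
      arcs (split_vertex u side p) (inl a) (inr i) = @adj (K3_graph u v side) (inl a) (inr i).
    have [au|au] := eqVneq (val a) u; first by rewrite !split_arcs_ur // Euv /= au eqxx.
    by rewrite !split_arcs_lr // -mulnDl E mulnb /= (negbTE au).
  move=> [a|i] [b|j]; first by rewrite !split_arcs_l E.
  + exact: lr.
  + by rewrite ![arcs _ (inr _) _]arcsC lr.
  + rewrite !split_arcs_r ?noloop.1 ?noloop.2 // -mulnDr.
    rewrite (_ : (_ == 0) + (_ == 0) = 1) ?muln1 //; move: Euv; clear.
    by case: (arcs t u v) => [|[|]] //; case: (arcs p u v) => [|[|]].
- exact: split_grounded.
- exact: (split_rooted u side rt).
- exact: (split_rooted u side rp).
Qed.


Section ExpandVertex.
Variables (G : sgraph) (K : {set G}).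
Hypothesis uK : forall v, v \notin K -> {in K &, forall w w', adj v w -> adj v w' -> w = w'}.

Let C := contract K.

Definition foot (x : G) : G := odflt x [pick k in K | adj x k].

(** The arc out of the contracted vertex must start at the neighbour in [K] of its target; if there
    is no such arc, any [k0] in [K] will do. *)
Definition exit_foot (k0 : G) (s : C -> option C) : G :=
  if s None is Some (Some b) then foot (val b) else k0.

(* [f] is an orientation inside [K] with root [w], the vertex of [K] from which
   the arc leaving the contracted vertex now starts. *)
Definition expand (w : G) (f : G -> option G) (s : C -> option C) (x : G) : option G :=
  if insub x is Some a then omap (oapp val (foot x)) (s (Some a))
  else if x == w then omap (oapp val w) (s None) else f x.

Definition shrink (x : G) : C := insub x.

Let Some_eq (T : eqType) (x y : T) : (Some x == Some y) = (x == y). Proof. by []. Qed.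

Lemma footP (x k : G) : x \notin K -> k \in K ->
  adj x k = @adj C (shrink x) None && (foot x == k).
Proof.
move=> xK kK; rewrite /shrink insubT /= /foot; case: pickP => [k' /andP[k'K xk']|none] /=.
  have -> : [exists w in K, adj x w] by apply/exists_inP; exists k'.
  by apply/idP/eqP => [xk|<-//]; apply: (uK xK k'K kK).
have -> : [exists w in K, adj x w] = false.
  by apply/existsP=> -[y /andP[yK xy]]; have := none y; rewrite yK xy.
by have := none k; rewrite kK.
Qed.

Variables (w : G) (f : G -> option G).
Hypothesis wK : w \in K.
Hypothesis fK : forall x y, f x = Some y -> y \in K.
Hypothesis fN : forall x, x \in K -> (f x == None) = (x == w).

Implicit Types (s : C -> option C) (a b : {x : G | x \notin K}).

Lemma foot_in (x : G) s : x \notin K -> s (shrink x) = Some None ->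
  arcs s (shrink x) None <= @adj C (shrink x) None -> foot x \in K.
Proof.
move=> xK sx; rewrite /arcs sx eqxx /shrink insubT /=.
case: existsP => [[k /andP[kK xk]] _|]; last by [].
by rewrite /foot; case: pickP => [? /andP[]|/(_ k)] //=; rewrite kK xk.
Qed.

Section Arcs.
Variable s : C -> option C.
Hypothesis sC : forall x y, arcs s x y <= adj x y.
Hypothesis sw : forall b, s None = Some (Some b) -> foot (val b) = w.

Lemma expand_out (x : G) : x \notin K ->
  expand w f s x = omap (oapp val (foot x)) (s (shrink x)).
Proof. by move=> xK; rewrite /expand /shrink insubT. Qed.

Lemma expand_in (k : G) : k \in K ->
  expand w f s k = if k == w then omap (oapp val w) (s None) else f k.
Proof. by move=> kK; rewrite /expand insubN ?negbK. Qed.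

Lemma s_None : s None != Some None.
Proof. by apply/eqP=> E; have := sC None None; rewrite adj_irr /arcs E eqxx. Qed.

Lemma expand_oo x y : x \notin K -> y \notin K ->
  (expand w f s x == Some y) = (s (shrink x) == Some (shrink y)).
Proof.
move=> xK yK; rewrite expand_out //; case E: (s (shrink x)) => [[b|]|] //=.
  by rewrite /shrink [insub y]insubT !Some_eq -val_eqE.
rewrite !Some_eq /shrink [insub y]insubT; apply/negbTE; apply: contraNneq yK => <-.
exact: (foot_in xK E (sC _ _)).
Qed.

Lemma expand_ok x k : x \notin K -> k \in K ->
  (expand w f s x == Some k) = (s (shrink x) == Some None) && (foot x == k).
Proof.
move=> xK kK; rewrite expand_out //; case E: (s (shrink x)) => [[b|]|] //=.
rewrite !Some_eq; apply/negbTE; apply: contraTneq kK => <-; exact: (valP b).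
Qed.

Lemma expand_ko x k : x \notin K -> k \in K ->
  (expand w f s k == Some x) = (k == w) && (s None == Some (shrink x)).
Proof.
move=> xK kK; rewrite expand_in //; case: (k == w) => /=; last first.
  by apply/negP=> /eqP/fK; rewrite (negbTE xK).
have := s_None; rewrite /shrink insubT; case: (s None) => [[b|]|] //= _.
Qed.

Lemma expand_kk k k' : k \in K -> k' \in K -> (expand w f s k == Some k') = (f k == Some k').
Proof.
move=> kK k'K; rewrite expand_in //; case: (eqVneq k w) => // ->.
have := fN wK; rewrite eqxx => /eqP->; have := s_None; case: (s None) => [[b|]|] //= _.
by rewrite Some_eq; apply: contraTF k'K => /eqP <-; exact: (valP b).
Qed.

Lemma expand_arcs_oo x y : x \notin K -> y \notin K ->
  arcs (expand w f s) x y = arcs s (shrink x) (shrink y).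
Proof. by move=> xK yK; rewrite /arcs !expand_oo. Qed.

Lemma expand_arcs_ok x k : x \notin K -> k \in K ->
  arcs (expand w f s) x k = arcs s (shrink x) None * (foot x == k).
Proof.
move=> xK kK; rewrite /arcs expand_ok // expand_ko // mulnDl -!mulnb; congr (_ + _).
rewrite mulnC; case E: (s None == _); rewrite ?mul0n // !mul1n.
move/eqP: E; rewrite /shrink insubT => /sw /= ->.
by rewrite eq_sym.
Qed.

Lemma expand_arcs_kk k k' : k \in K -> k' \in K -> arcs (expand w f s) k k' = arcs f k k'.
Proof. by move=> kK k'K; rewrite /arcs !expand_kk. Qed.

Lemma expand_rooted o : rooted s o -> rooted (expand w f s) (omap (oapp val w) o).
Proof.
move=> rs x; have [xK|xK] := boolP (x \in K).
  have oE : (omap (oapp val w) o == Some x) = (x == w) && (o == Some None).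
    case: o {rs} => [[b|]|] /=; rewrite ?andbF // Some_eq; last by rewrite eqxx andbT eq_sym.
    by apply: contraTF xK => /eqP <-; exact: (valP b).
  rewrite oE expand_in // -rs; have [xw|xw] := eqVneq x w; last by rewrite fN // (negbTE xw).
  by have := s_None; case: (s None).
rewrite expand_out //; have -> : (omap (oapp val w) o == Some x) = (o == Some (shrink x)).
  rewrite /shrink insubT; case: o {rs} => [[b|]|] //=; rewrite !Some_eq -?val_eqE //.
  by apply/negbTE; apply: contraNneq xK => <-.
by rewrite -rs; case: (s _).
Qed.

(** When the contracted vertex is the witness, take a vertex of [K :&: X] of least depth: its parent
    in [K] is outside [X], or it is [w] and carries the arc of the contracted vertex. *)
Lemma expand_grounded (d : G -> nat) :
  (forall x y, x \in K -> f x = Some y -> d y < d x) -> grounded s -> grounded (expand w f s).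
Proof.
move=> dP gs X X0; have [|_ /imsetP[x xX ->] H] := gs (shrink @: X); first by rewrite imset_eq0.
have out y z : s (shrink x) = Some y -> shrink z = y -> z \notin X.
  by move=> sx zy; have := H y sx; rewrite -zy; apply: contra => zX; apply: imset_f.
have sK k : k \in K -> shrink k = None by move=> kK; rewrite /shrink insubN ?negbK.
have [xK|xK] := boolP (x \in K); last first.
  exists x => // z /eqP; rewrite expand_out //.
  case E: (s (shrink x)) => [y|] //= /eqP[<-]; apply: (out y) => //.
  case: y E => [b|] E /=; first exact: valK.
  by apply: sK; apply: (foot_in xK E (sC _ _)).
have xKX : x \in K :&: X by rewrite inE xK.
case: (arg_minnP d xKX) => k /setIP[kK kX] dmin; exists k => // z; rewrite expand_in //.
case: (eqVneq k w) => [_|kw fz].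
  rewrite -(sK x xK); case E: (s (shrink x)) => [[b|]|] //= [<-].
    by apply: (out _ _ E); apply: valK.
  by case/eqP: s_None; rewrite -{1}(sK x xK).
have zK := fK fz; apply/negP=> zX.
have /dmin : z \in K :&: X by rewrite inE zK zX.
by rewrite leqNgt (dP k z).
Qed.

End Arcs.
End ExpandVertex.

(** K4 is the union of the paths [w1 k1 k2 k3] and [k2 w1 k3 k1]. The first is directed to its end
    [w1]; the second to [w2], which is [w1] or, after naming the vertices suitably, [k1]. The depth
    [d] belongs to [f], which will continue the tree. *)
Lemma K4_two_trees (T : finType) (K : {set T}) (w1 w2 : T) : #|K| = 4 -> w1 \in K -> w2 \in K ->
  exists (f g : T -> option T) (d : T -> nat),
  [/\ {in K &, forall x y, arcs f x y + arcs g x y = (x != y)},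
      forall x y, f x = Some y -> y \in K /\ d y < d x,
      forall x y, g x = Some y -> y \in K,
      {in K, forall x, (f x == None) = (x == w1)}
    & {in K, forall x, (g x == None) = (x == w2)}].
Proof.
move=> K4 w1K w2K.
have [k1 [k2 [k3 [us EK w2E]]]] : exists k1 k2 k3, [/\ uniq [:: w1; k1; k2; k3],
    K =i [:: w1; k1; k2; k3] & w2 = w1 \/ w2 = k1].
  have [k1 k1K w2E] : exists2 k1, k1 \in K :\ w1 & w2 = w1 \/ w2 = k1.
    have [->|w21] := eqVneq w2 w1; last by exists w2; [rewrite !inE w21|right].
    have /set0Pn[k1 k1K] : K :\ w1 != set0.
      by rewrite -card_gt0; have := cardsD1 w1 K; rewrite w1K K4; clear; lia.
    by exists k1 => //; left.
  have c2 : #|K :\ w1 :\ k1| = 2.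
    by have := cardsD1 w1 K; have := cardsD1 k1 (K :\ w1); rewrite w1K K4 k1K; clear; lia.
  have /eqP/cards2P[k2 [k3 [k23 E]]] := c2.
  have k2K : k2 \in K :\ w1 :\ k1 by rewrite E !inE eqxx.
  have k3K : k3 \in K :\ w1 :\ k1 by rewrite E !inE eqxx orbT.
  exists k1, k2, k3; split=> //.
    move: k1K k2K k3K; rewrite /= !inE => /andP[k1w _] /and3P[a b _] /and3P[c e _].
    by rewrite !negb_or ![w1 == _]eq_sym [k1 == k2]eq_sym [k1 == k3]eq_sym k1w a b c e k23.
  move=> x; rewrite !inE; have /setP/(_ x) := E; rewrite !inE.
  case: (eqVneq x w1) => [->|_] //=; case: (eqVneq x k1) k1K => [->|_] //=.
  by rewrite !inE => /andP[].
move: us; rewrite /= !inE !negb_or => /and3P[/and3P[a b c] /andP[e h] /andP[i _]].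
have neqs := (negbTE a, negbTE b, negbTE c, negbTE e, negbTE h, negbTE i).
have sneqs : ((k1 == w1) = false) * ((k2 == w1) = false) * ((k3 == w1) = false) *
  ((k2 == k1) = false) * ((k3 == k1) = false) * ((k3 == k2) = false).
  by do !split; rewrite eq_sym neqs.
have SE (x y : T) : (Some x == Some y) = (x == y) by [].
pose f x :=
  if x == k1 then Some w1 else if x == k2 then Some k1 else if x == k3 then Some k2 else None.
have f0 : f w1 = None by rewrite /f !neqs.
have f1 : f k1 = Some w1 by rewrite /f eqxx.
have f2 : f k2 = Some k1 by rewrite /f !sneqs eqxx.
have f3 : f k3 = Some k2 by rewrite /f !sneqs eqxx.
pose g x := if w2 == w1 then
    (if x == k1 then Some k3 else if x == k2 then Some w1 else if x == k3 then Some w1 else None)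
  else
    (if x == k2 then Some w1 else if x == w1 then Some k3 else if x == k3 then Some k1 else None).
exists f, g, (index^~ [:: w1; k1; k2; k3]); split.
- move=> x y; rewrite !EK !inE /arcs => xK yK.
  have [g0 g1 g2 g3] : [/\ g w1 = if w2 == w1 then None else Some k3,
    g k1 = if w2 == w1 then Some k3 else None, g k2 = Some w1 &
    g k3 = if w2 == w1 then Some w1 else Some k1].
    by rewrite /g; split; rewrite ?neqs ?sneqs ?eqxx; case: eqP.
  have ww : (w2 == w1) = true \/ (w2 == w1) = false by case: eqP; auto.
  by case/or4P: xK => /eqP->; case/or4P: yK => /eqP->; rewrite ?f0 ?f1 ?f2 ?f3 ?g0 ?g1 ?g2 ?g3;
    case: ww => E; rewrite ?E /= ?SE ?neqs ?sneqs ?eqxx ?neqs ?sneqs.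
- move=> x y; rewrite /f; case: (eqVneq x k1) => [->|_].
    by case=> <-; rewrite EK !inE /= ?eqxx ?neqs ?sneqs ?orbT.
  case: (eqVneq x k2) => [->|_].
    by case=> <-; rewrite EK !inE /= ?eqxx ?neqs ?sneqs ?orbT.
  case: (eqVneq x k3) => [->|_] //.
  by case=> <-; rewrite EK !inE /= ?eqxx ?neqs ?sneqs ?orbT.
- move=> x y; rewrite EK /g.
  by repeat (case: ifP => _); try discriminate; case=> <-; rewrite !inE eqxx ?orbT.
- move=> x; rewrite EK !inE.
  by case/or4P=> /eqP->; rewrite ?f0 ?f1 ?f2 ?f3 ?eqxx ?sneqs.
- move=> x; rewrite EK !inE /g.
  by case: w2E => ->; case/or4P=> /eqP->; rewrite ?eqxx ?neqs ?sneqs /= ?eqxx ?neqs ?sneqs.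
Qed.

Lemma oriented_vertex_to_K4 (G : sgraph) (K : {set G}) : #|K| = 4 ->
  {in K &, forall x y, x != y -> adj x y} ->
  (forall v, v \notin K -> {in K &, forall w w', adj v w -> adj v w' -> w = w'}) ->
  oriented (contract K) -> oriented G.
Proof.
move=> K4 clK uK [t [p [r [E gt rt rp]]]].
have [k0 k0K] : exists k, k \in K by apply/card_gt0P; rewrite K4.
have tC x y : arcs t x y <= adj x y by rewrite -E leq_addr.
have pC x y : arcs p x y <= adj x y by rewrite -E leq_addl.
have exitK (s : contract K -> option (contract K)) :
    (forall x y, arcs s x y <= adj x y) -> exit_foot k0 s \in K.
  move=> sC; rewrite /exit_foot; case sN: (s None) => [[b|]|] //.
  have := sC None (Some b); rewrite /arcs sN eqxx /=.
  case: existsP => [[k /andP[kK bk]] _|]; last by [].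
  by rewrite /foot; case: pickP => [k' /andP[] //|/(_ k)]; rewrite /= kK bk.
have sw (s : contract K -> option (contract K)) b :
    s None = Some (Some b) -> foot K (val b) = exit_foot k0 s.
  by rewrite /exit_foot => ->.
have w1K := exitK t tC; have w2K := exitK p pC.
have [f [g [d [Efg fK gK fN gN]]]] := K4_two_trees K4 w1K w2K.
have fK' x y : f x = Some y -> y \in K by case/fK.
exists (expand (exit_foot k0 t) f t), (expand (exit_foot k0 p) g p); eexists; split.
- have ok x k : x \notin K -> k \in K -> arcs (expand (exit_foot k0 t) f t) x k + 
      arcs (expand (exit_foot k0 p) g p) x k = adj x k.
    move=> xK kK; rewrite !expand_arcs_ok //; try exact: sw.
    by rewrite -mulnDl E mulnb -footP.
  move=> x y; have [xK|xK] := boolP (x \in K); have [yK|yK] := boolP (y \in K).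
  + rewrite !expand_arcs_kk // Efg //; case: eqP => [->|/eqP xy]; first by rewrite adj_irr.
    by rewrite clK.
  + by rewrite ![arcs _ x y]arcsC ok // adj_sym.
  + exact: ok.
  + by rewrite !expand_arcs_oo // E /shrink !insubT.
- by apply: (@expand_grounded _ _ _ _ fK' _ tC d) => // x y _ /fK[].
- exact: (expand_rooted w1K fN tC rt).
- exact: (expand_rooted w2K gN pC rp).
Qed.

Lemma grounded_ind (T : finType) (s : T -> option T) (P : T -> Prop) : grounded s ->
  (forall x, (forall y, s x = Some y -> P y) -> P x) -> forall x, P x.
Proof.
move=> gs IH; suff H n (X : {set T}) : #|X| <= n -> (forall y, y \notin X -> P y) -> forall x, P x.
  by apply: (H #|T| setT) => [|y]; rewrite ?max_card ?inE.
elim: n X => [|n IHn] X cX PX x.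
  by apply: PX; move: cX; rewrite leqn0 cards_eq0 => /eqP->; rewrite inE.
have [X0|/gs[y yX sy]] := eqVneq X set0; first by apply: PX; rewrite X0 inE.
apply: (IHn (X :\ y)) => [|z]; first by rewrite (cardsD1 y X) yX in cX.
rewrite !inE negb_and negbK => /orP[/eqP->|/PX//]; apply: IH => z' /sy; exact: PX.
Qed.

(** The root moves away from [r] one arc at a time: once [y = s x] is the root, reversing the arc
    from [x] to [y] makes [x] the root. *)
Lemma reroot (T : finType) (s : T -> option T) (r : T) :
  (forall x y, arcs s x y <= 1) -> grounded s -> rooted s (Some r) ->
  forall x, exists s', [/\ arcs s' =2 arcs s, grounded s' & rooted s' (Some x)].
Proof.
move=> s1 gs rs; apply: (grounded_ind gs) => x IH.
case sx: (s x) => [y|]; last first.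
  have /eqP[<-] : Some r == Some x by rewrite -rs sx.
  by exists s.
have [s' [E gs' rs']] := IH y sx.
have yN : s' y = None by apply/eqP; rewrite rs'.
have s'x : s' x = Some y.
  by have := E x y; rewrite /arcs yN sx eqxx /= addn0; case: (s' x =P Some y).
have xy : x != y by apply/eqP=> xy; rewrite xy yN in s'x.
pose s2 z := if z == y then Some x else if z == x then None else s' z.
have SE (a b : T) : (Some a == Some b) = (a == b) by [].
exists s2; split.
- move=> a b; rewrite -E /arcs /s2.
  case: (eqVneq a y) => [->|ay]; case: (eqVneq b y) => [->|yb].
  + by rewrite yN SE (negbTE xy).
  + rewrite yN SE add0n; case: (eqVneq b x) => [->|bx] /=.
      by rewrite s'x ?eqxx.
    by rewrite ?[x == b]eq_sym ?(negbTE bx).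
  + rewrite yN SE addn0; case: (eqVneq a x) => [->|ax] /=.
      by rewrite s'x ?eqxx.
    by rewrite ?[x == a]eq_sym ?(negbTE ax) ?addn0.
  + have [ya yb' yx] : [/\ (y == a) = false, (y == b) = false & (y == x) = false].
      by rewrite ![y == _]eq_sym (negbTE ay) (negbTE yb) (negbTE xy).
    case: (eqVneq a x) => [->|ax]; case: (eqVneq b x) => [->|bx] //=;
    by rewrite s'x SE ?ya ?yb' ?yx.
- move=> X X0; have [a aX H] := gs' X X0.
  have [xX|xX] := boolP (x \in X).
    by exists x => // z; rewrite /s2 (negbTE xy) eqxx.
  exists a => // z; rewrite /s2; case: eqP => [_ [<-] //|_].
  by case: eqP => // _ /H.
- move=> z; rewrite /s2; case: (eqVneq z y) => [->|zy]; first by rewrite SE (negbTE xy).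
  rewrite SE; case: (eqVneq z x) => [//|zx].
  by rewrite rs' SE eq_sym (negbTE zy).
Qed.

Lemma oriented_join (K H : sgraph) (u : K) (v : H) :
  oriented K -> oriented H -> oriented (join_graph u v).
Proof.
move=> [t1 [p1 [r1 [E1 gt1 rt1 rp1]]]] [t2' [p2 [r2 [E2' gt2' rt2' rp2]]]].
(* Only a root can accept a further tree arc, so the tree of [H] is rerooted at [v] before the arc
   from [v] to [u] is added. *)
have [x y|t2 [Et2 gt2 rt2]] := @reroot _ t2' r2 _ gt2' rt2' v.
  by apply: leq_trans (leq_addr (arcs p2 x y) _) _; rewrite E2' leq_b1.
have E2 x y : arcs t2 x y + arcs p2 x y = adj x y by rewrite Et2.
pose t (x : (K + H)%type) : option (K + H)%type :=
  match x with
  | inl a => omap inl (t1 a)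
  | inr b => if b == v then Some (inl u) else omap inr (t2 b)
  end.
pose p (x : (K + H)%type) : option (K + H)%type :=
  match x with inl a => omap inl (p1 a) | inr b => omap inr (p2 b) end.
have SE (T : eqType) (a b : T) : (Some a == Some b) = (a == b) by [].
have ll (s : K -> option K) a b : (omap inl (s a) == Some (inl b : K + H)%type) = (s a == Some b).
  by case: (s a).
have rr (s : H -> option H) a b : (omap inr (s a) == Some (inr b : K + H)%type) = (s a == Some b).
  by case: (s a).
have lr (s : K -> option K) a b : (omap inl (s a) == Some (inr b : K + H)%type) = false.
  by case: (s a).
have rl (s : H -> option H) a b : (omap inr (s a) == Some (inl b : K + H)%type) = false.
  by case: (s a).
have t2v : t2 v = None by apply/eqP; rewrite rt2.
have trr a b : (t (inr a) == Some (inr b)) = (t2 a == Some b).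
  by rewrite /t; case: (eqVneq a v) => [->|_]; [rewrite t2v|apply: rr].
have tlr a b : arcs t (inl a) (inr b) + arcs p (inl a) (inr b) = (a == u) && (b == v).
  rewrite /arcs /p rl lr !addn0 /t lr add0n; case: (b == v); rewrite ?rl ?andbF //.
  by rewrite -[Some (inl u) == _]/(u == a) eq_sym; case: (a == u).
exists t, p, (inl r1); split.
- move=> [a|a] [b|b].
  + by rewrite /arcs /t /p !ll E1.
  + exact: tlr.
  + by rewrite ![arcs _ (inr _) _]arcsC; apply: tlr.
  + by rewrite /arcs !trr /p !rr E2.
- move=> X X0; pose Y1 := [set a | inl a \in X]; pose Y2 := [set b | inr b \in X].
  have [Y10|/gt1[a]] := eqVneq Y1 set0; last first.
    rewrite inE => aX Ha; exists (inl a) => // z /=.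
    by case E: (t1 a) => [c|] //= [<-]; have := Ha c E; rewrite inE.
  have NX a : inl a \notin X by have /setP/(_ a) := Y10; rewrite !inE => ->.
  have [Y20|/gt2[b]] := eqVneq Y2 set0.
    case/set0Pn: X0 => -[a|b] zX; first by rewrite (negbTE (NX a)) in zX.
    by have /setP/(_ b) := Y20; rewrite !inE zX.
  rewrite inE => bX Hb; exists (inr b) => // z /=; case: eqP => _; first by case=> <-.
  by case E: (t2 b) => [c|] //= [<-]; have := Hb c E; rewrite inE.
- move=> [a|b] /=; first by have := rt1 a; case: (t1 a).
  case: (eqVneq b v) => [//|bv]; have := rt2 b.
  by rewrite SE [v == b]eq_sym (negbTE bv); case: (t2 b).
- by move=> [a|b] /=; [have := rp1 a; case: (p1 a)|have := rp2 b; case: (p2 b)].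
Qed.

(** The entry [n], outside ['I_n], marks a root. *)
Definition table (n : nat) (l : seq nat) (x : 'I_n) : option 'I_n := insub (nth n l x).

Lemma tableE n l (x y : 'I_n) : (table l x == Some y) = (nth n l x == y).
Proof.
rewrite /table; case: insubP => [z _ zE|]; first by rewrite -zE.
rewrite -leqNgt => ge; apply/esym/negbTE; rewrite neq_ltn.
by rewrite (leq_trans (ltn_ord y) ge) orbT.
Qed.

Lemma tableN n l (x : 'I_n) : (table l x == None) = (n <= nth n l x).
Proof. by rewrite /table leqNgt; case: insubP => [z -> _|/negbTE->]. Qed.

Lemma oriented_base : oriented K5e /\ oriented K4K4.
Proof.
split.
  (* The second table is the 4-cycle 0, 3, 1, 4 with 2 attached to 4. *)
  exists (@table 5 [:: 2; 2; 5; 2; 3]), (@table 5 [:: 3; 4; 4; 1; 0]), (@Ordinal 5 2 isT); split.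
  - by move=> [x Hx] [y Hy]; rewrite /arcs !tableE /=;
      case: x y Hx Hy => [|[|[|[|[|//]]]]] [|[|[|[|[|//]]]]].
  - apply: (@grounded_depth _ _ (fun x => nth 0 [:: 1; 1; 0; 1; 2] (x : 'I_5))) => x y /eqP.
    rewrite tableE => /eqP; case: x y => [x Hx] [y Hy] /=.
    by case: x Hx => [|[|[|[|[|//]]]]] //= _ yE; move: Hy; rewrite -yE.
  - by move=> [x Hx]; rewrite tableN; case: x Hx => [|[|[|[|[|//]]]]].
  - by move=> [x Hx]; rewrite tableN /=; case: x Hx => [|[|[|[|[|//]]]]].
(* The second table is the triangle 2, 5, 3 with 0, 1 and 4 attached to it. *)
exists (@table 6 [:: 1; 2; 6; 0; 2; 4]), (@table 6 [:: 2; 3; 5; 2; 3; 3]).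
exists (@Ordinal 6 2 isT); split.
- by move=> [x Hx] [y Hy]; rewrite /arcs !tableE /=;
    case: x y Hx Hy => [|[|[|[|[|[|//]]]]]] [|[|[|[|[|[|//]]]]]].
- apply: (@grounded_depth _ _ (fun x => nth 0 [:: 2; 1; 0; 3; 1; 2] (x : 'I_6))) => x y /eqP.
  rewrite tableE => /eqP; case: x y => [x Hx] [y Hy] /=.
  by case: x Hx => [|[|[|[|[|[|//]]]]]] //= _ yE; move: Hy; rewrite -yE.
- by move=> [x Hx]; rewrite tableN; case: x Hx => [|[|[|[|[|[|//]]]]]].
- by move=> [x Hx]; rewrite tableN /=; case: x Hx => [|[|[|[|[|[|//]]]]]].
Qed.

Lemma iso_sym (G H : sgraph) : iso G H -> iso H G.
Proof.
case=> h [g hK gK] hom; exists g; first by exists h.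
by move=> x y; rewrite -hom !gK.
Qed.

Lemma derivable_oriented (G : sgraph) : derivable G -> oriented G.
Proof.
have [o1 o2] := oriented_base.
elim=> {G} [G /oriented_iso|G /oriented_iso|G G' _ oG|G G' _ oG|G G' _ oG
  |K H G _ oK _ oH|G G' _ oG].
- exact.
- exact.
- by case=> u [v [uv /oriented_iso]]; apply; apply: oriented_H1.
- by case=> u [v [w [uv wu wv /oriented_iso]]]; apply; apply: oriented_H2 => //; apply: adj_neq.
- case=> L [L4 clL uL /iso_sym/oriented_iso/(_ oG)]; exact: oriented_vertex_to_K4.
- by case=> _ _ [u [v /oriented_iso]]; apply; apply: oriented_join.
- by case=> u [v [side [uv /oriented_iso]]]; apply; apply: oriented_K3.
Qed.


(** * Cycles, forests and unicyclic graphs *)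

Lemma next_next_neq (T : eqType) (p : seq T) (x : T) :
  uniq p -> 2 < size p -> x \in p -> next p (next p x) != x.
Proof.
move=> up sp xp; have [i q E] := rot_to xp.
have uq : uniq (x :: q) by rewrite -E rot_uniq.
have sq : 1 < size q by move: sp; rewrite -(size_rot i p) E.
rewrite -!(next_rot i up) E; case: q uq sq {E} => [|y [|z q]] //= uq _.
move: uq; rewrite !inE !negb_or -!andbA => /and5P[xy xz _ yz _].
by rewrite !eqxx [y == x]eq_sym (negbTE xy) /= eq_sym.
Qed.

Section FunctionalCycles.
Variables (V : finType) (F : {set {set V}}) (f : V -> V).
Hypothesis F_loopless : forall x y, edge_rel F x y -> x != y.
Hypothesis F_arc : forall x y, edge_rel F x y -> (f x == y) (+) (f y == x).

(* Each vertex has one outgoing arc, so the arcs of a cycle all follow it in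
   the same direction. *)
Lemma cycle_fcycle (C : {set {set V}}) : is_cycle F C -> exists c : seq V,
  [/\ 2 < size c, fcycle f c, uniq c, cycle (edge_rel F) c & C = [set [set x; f x] | x in c]].
Proof.
case=> p [sp /andP[cp up] EC].
have [/allP all_next|/allPn[x0 x0p nx0]] := boolP (all (fun x => f x == next p x) p).
  exists p; split=> //; first by apply: cycle_from_next.
  by rewrite EC; apply: eq_in_imset => x xp; rewrite (eqP (all_next x xp)).
(* A backward arc propagates: [next p x] has spent its only arc on [x], so the following edge must
   be an arc into [next p x]. *)
have step x : x \in p -> f (next p x) = x -> f (next p (next p x)) = next p x.
  move=> xp fx; have np : next p x \in p by rewrite mem_next.
  have := F_arc (next_cycle cp np); rewrite fx eq_sym (negbTE (next_next_neq up sp xp)).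
  by move/eqP.
have all_prev x : x \in p -> f (next p x) = x.
  rewrite -(fconnect_cycle (cycle_next up) x0p) => /iter_findex <-.
  elim: findex => [|n IH] /=.
    by have := F_arc (next_cycle cp x0p); rewrite (negbTE nx0) => /eqP.
  by apply: step => //; elim: n {IH} => [|n IH] //=; rewrite mem_next.
have uq : uniq (rev p) by rewrite rev_uniq.
have fprev x : x \in p -> f x = prev p x.
  by move=> xp; rewrite -{1}(next_prev up x) all_prev // mem_prev.
exists (rev p); split=> //; first by rewrite size_rev.
- apply: cycle_from_next => // x; rewrite mem_rev => xp.
  by rewrite next_rev //= fprev.
- by rewrite rev_cycle -(@eq_cycle _ (edge_rel F)) // => x y; rewrite /edge_rel setUC.
- rewrite EC; apply/setP=> e; apply/imsetP/imsetP => -[x xp ->].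
    by exists (next p x); rewrite ?mem_rev ?mem_next // all_prev // setUC.
  rewrite mem_rev in xp; exists (prev p x); first by rewrite mem_prev.
  by rewrite next_prev // fprev // setUC.
Qed.

(** The forward orbit of [x] runs into a cycle. Forward orbits of connected vertices meet, so two
    cycles of one component share a vertex and, being orbits of [f], coincide. *)
Lemma components_unicyclic_functional :
  (forall x, edge_rel F x (f x)) -> (forall x y, edge_rel F x y -> f x = y \/ f y = x) ->
  components_unicyclic F.
Proof.
move=> Ff FE x.
have [y [xy cy]] : exists y, fconnect f x y /\ fcycle f (orbit f y).
  have /trajectP[i lt_i E] := looping_order f x.
  exists (iter i f x); split; first exact: fconnect_iter.
  apply/(orbitPcycle 3 0); exists (order f x - i).-1.
  by rewrite prednK ?subn_gt0 // -iterD subnK // ltnW.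
have subF : subrel (fconnect f) (connect (edge_rel F)).
  by apply: connect_sub => a b /eqP <-; apply: connect1.
have symF : connect_sym (edge_rel F).
  by apply: sym_connect_sym => a b; rewrite /edge_rel setUC.
have ySelf : y \in orbit f y by rewrite -fconnect_orbit.
have fyc z : z \in orbit f y -> f z \in orbit f y.
  by rewrite -!fconnect_orbit => yz; apply: connect_trans yz (fconnect1 _ _).
(* Period 1 would be a loop, and period 2 an edge used in both directions, which the exclusive or in
   [F_arc] rules out. *)
have size_orb : 2 < size (orbit f y).
  rewrite size_orbit ltn_neqAle; have /(orbitPcycle 0 4) itn := cy.
  have := F_loopless (Ff y); have := F_arc (Ff y); rewrite eqxx => n2 n1.
  have := order_gt0 f y; move: itn; case: (order f y) => [|[|[|n]]] //= E _.
  - by move: n1; rewrite E eqxx.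
  - by move: n2; rewrite E eqxx.
exists [set [set z; f z] | z in orbit f y]; split.
  split.
    exists (orbit f y); split=> //.
      rewrite /ucycle orbit_uniq andbT; apply: cycle_from_next; first exact: orbit_uniq.
      by move=> z zy; rewrite (nextE cy zy).
    by apply: eq_in_imset => z zy; rewrite (nextE cy zy).
  apply/subsetP=> z /bigcupP[_ /imsetP[a ay ->]]; rewrite !inE => /orP[] /eqP->; apply: subF;
    apply: (connect_trans xy); rewrite fconnect_orbit ?fyc //.
move=> C' [cC' sC']; have [c [sc fc uc ec EC']] := cycle_fcycle cC'.
have fcc z : z \in c -> f z \in c by move=> zc; rewrite -(nextE fc zc) mem_next.
have [z zc] : exists z, z \in c.
  by case: c sc {fc uc ec EC' fcc} => [|z c] // _; exists z; rewrite mem_head.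
have xz : connect (edge_rel F) x z.
  have /subsetP/(_ z) := sC'; apply; rewrite EC'; apply/bigcupP.
  exists [set z; f z]; last exact: set21.
  by apply/imsetP; exists z.
have join a b : connect (edge_rel F) a b -> exists n m, iter n f a = iter m f b.
  case/connectP=> p; elim: p a => [|d p IH] a /=; first by move=> _ ->; exists 0, 0.
  case/andP=> /FE ad dp /(IH _ dp)[n [m E]]; case: ad => [ad|ad].
    by exists n.+1, m; rewrite iterSr ad.
  by exists n, m.+1; rewrite -ad -iterSr /= E.
have citer (g : seq V) n a : {in g, forall b, f b \in g} -> a \in g -> iter n f a \in g.
  by move=> gf ag; elim: n => //= n; apply: gf.
have [n [m E]] := join x z xz; have yE := iter_findex xy.
(* Read in the two orders, this iterate is reached from [y] and from [z], so it lies on both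
   cycles. *)
pose w := iter (n + findex f x y) f x.
have wy : w \in orbit f y by rewrite /w iterD yE; apply: (citer (orbit f y)).
have wc : w \in c by rewrite /w addnC iterD E; apply: (citer c) => //; apply: (citer c).
have cy' : c =i orbit f y.
  by move=> a; rewrite -(fconnect_cycle fc wc) (fconnect_cycle cy wy).
rewrite EC'; apply/setP=> e; apply/imsetP/imsetP => -[a ac ->]; exists a => //;
  by rewrite ?cy' // -cy'.
Qed.

End FunctionalCycles.


Definition arc_edges (V : finType) (s : V -> option V) : {set {set V}} :=
  [set [set a.1; a.2] | a : V * V & s a.1 == Some a.2].

Lemma in_arc_edges (V : finType) (s : V -> option V) x y :
  ([set x; y] \in arc_edges s) = (0 < arcs s x y).
Proof.
rewrite /arcs addn_gt0 !lt0b; apply/imsetP/orP => [[[a b]]|[] sxy]; last 2 first.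
- by exists (x, y); rewrite ?inE.
- by exists (y, x); rewrite ?inE //= setUC.
by rewrite inE /= => sab /eq_set2P[[-> ->]|[-> ->]]; auto.
Qed.

Section FromArcs.
Variables (V : finType) (s : V -> option V).
Hypothesis s1 : forall x y, arcs s x y <= (x != y).

(** The root becomes a fixed point, which creates no arc because edges join distinct vertices. *)
Let f x := odflt x (s x).

Let F_loopless x y : edge_rel (arc_edges s) x y -> x != y.
Proof. by rewrite /edge_rel in_arc_edges; have := s1 x y; case: eqP => //; case: arcs. Qed.

Let F_or x y : edge_rel (arc_edges s) x y -> f x = y \/ f y = x.
Proof.
rewrite /edge_rel in_arc_edges /arcs addn_gt0 !lt0b /f.
by case/orP=> /eqP->; auto.
Qed.

Let f_arc x y : x != y -> (f x == y) = (s x == Some y).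
Proof. by rewrite /f; case: (s x) => [z|] //= /negbTE ->. Qed.

Let F_arc x y : edge_rel (arc_edges s) x y -> (f x == y) (+) (f y == x).
Proof.
move=> xy; have n := F_loopless xy; have n' : y != x by rewrite eq_sym.
have := s1 x y; rewrite n /arcs (f_arc n) (f_arc n').
by move: xy; rewrite /edge_rel in_arc_edges /arcs; case: (s x == _); case: (s y == _).
Qed.

Lemma spanning_tree_grounded r : grounded s -> rooted s (Some r) -> spanning_tree (arc_edges s).
Proof.
move=> gs rs; split.
- by apply/card_gt0P; exists r.
- have symF : connect_sym (edge_rel (arc_edges s)).
    by apply: sym_connect_sym => a b; rewrite /edge_rel setUC.
  have toR : forall x, connect (edge_rel (arc_edges s)) x r.
    apply: (grounded_ind gs) => x IH; case sx: (s x) => [y|].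
      apply: connect_trans (IH y sx); apply: connect1.
      by rewrite /edge_rel in_arc_edges /arcs sx eqxx.
    by have := rs x; rewrite sx => /esym/eqP[->].
  by move=> x y; apply: connect_trans (toR x) _; rewrite symF.
(* The vertex set of a cycle would be closed under [f] and contain no fixed point, against
   groundedness. *)
- move=> C /(cycle_fcycle F_arc)[c [sc fc uc ec _]].
  have [|x] := gs [set x in c].
    by case: c sc {fc uc ec} => [|z c] // _; apply/set0Pn; exists z; rewrite inE mem_head.
  rewrite inE => xc H; have fxc : f x \in c by rewrite -(nextE fc xc) mem_next.
  have := F_loopless (next_cycle ec xc); rewrite (nextE fc xc).
  case sx: (s x) => [y|]; last by rewrite /f sx eqxx.
  by have := H y sx; rewrite inE; rewrite /f sx in fxc; rewrite fxc.
Qed.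

Lemma components_unicyclic_total : rooted s None -> components_unicyclic (arc_edges s).
Proof.
move=> rs; apply: (components_unicyclic_functional F_loopless F_arc); last exact: F_or.
move=> x; rewrite /edge_rel in_arc_edges /arcs /f.
by have := rs x; case: (s x) => [y|] //= _; rewrite eqxx.
Qed.

End FromArcs.

Lemma oriented_tree_and_unicyclic (G : sgraph) : oriented G -> tree_and_unicyclic G.
Proof.
case=> t [p [r [E gt rt rp]]]; exists (arc_edges t), (arc_edges p).
have adj1 (x y : G) : adj x y <= (x != y) by case: eqP => [->|_]; rewrite ?adj_irr ?leq_b1.
have t1 x y : arcs t x y <= (x != y) by apply: leq_trans (adj1 x y); rewrite -E leq_addr.
have p1 x y : arcs p x y <= (x != y) by apply: leq_trans (adj1 x y); rewrite -E leq_addl.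
split; [| |exact: spanning_tree_grounded gt rt|exact: components_unicyclic_total].
- apply/setP=> e; rewrite inE; apply/orP/edgesP => [|[x [y [xy ->]]]]; last first.
    by rewrite !in_arc_edges; apply/orP; rewrite -addn_gt0 E xy.
  by case=> /[dup] /imsetP[[x y] _ ->]; rewrite in_arc_edges /= => xy; exists x, y;
    split=> //; have := E x y; case: (adj x y) => //; move: xy; clear; lia.
- rewrite -setI_eq0; apply/eqP/setP=> e; rewrite !inE; apply/negP=> /andP[eT eP].
  have /imsetP[[x y] _ Ee] := eT; move: eT eP; rewrite Ee !in_arc_edges /= => a b.
  by have := E x y; have := leq_b1 (adj x y); move: a b; clear; lia.
Qed.


(** * Counting the arcs of an orientation *)

Lemma sum_Some_eq (T : finType) (o : option T) (X : {set T}) :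
  \sum_(y in X) (o == Some y) = (if o is Some z then z \in X else false).
Proof.
case: o => [z|]; last by rewrite big1.
have Sz y : (Some z == Some y) = (y == z) by rewrite eq_sym.
have [zX|zX] := boolP (z \in X).
  rewrite (big_setD1 z) //= eqxx big1 // => y; rewrite !inE => /andP[yz _].
  by rewrite Sz (negbTE yz).
rewrite big1 // => y yX; rewrite Sz; case: eqP => // yz.
by rewrite -yz yX in zX.
Qed.

Lemma oriented_tight (G : sgraph) : oriented G -> tight 1 G.
Proof.
case=> t [p [r [E gt rt rp]]].
pose out (s : G -> option G) (X : {set G}) := \sum_(x in X) \sum_(y in X) (s x == Some y).
have arcsE s (X : {set G}) : \sum_(x in X) \sum_(y in X) arcs s x y = 2 * out s X.
  transitivity (out s X + \sum_(x in X) \sum_(y in X) (s y == Some x)).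
    by rewrite -big_split; apply: eq_bigr => x _; rewrite -big_split.
  by rewrite exchange_big mul2n -addnn.
have inE2 (X : {set G}) : #|inner X| = out t X + out p X.
  suff : 2 * #|inner X| = 2 * out t X + 2 * out p X by clear; lia.
  rewrite double_inner /links -!arcsE -big_split; apply: eq_bigr => x _.
  by rewrite card_nbrI -big_split; apply: eq_bigr => y _; rewrite -E.
have outT s (o : option G) : rooted s o -> out s setT + isSome o = #|G|.
  move=> rs; have -> : nat_of_bool (isSome o) = \sum_(x in [set: G]) (s x == None).
    rewrite (eq_bigr (fun x => nat_of_bool (o == Some x))); last by move=> x _; rewrite rs.
    by rewrite sum_Some_eq; case: o {rs} => // z; rewrite inE.
  rewrite /out -big_split -cardsT -sum1_card; apply: eq_bigr => x _.
  by rewrite sum_Some_eq /=; case: (s x) => [z|]; rewrite ?inE.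
apply/tightP; split=> [X /[dup] X0 /gt[x xX H]|].
  have oX s (Y : {set G}) : \sum_(y in Y) \sum_(z in X) (s y == Some z) <= #|Y|.
    rewrite -sum1_card; apply: leq_sum => y _.
    by rewrite sum_Some_eq; case: (s y) => [z|]; rewrite ?leq_b1.
  have tX : \sum_(y in X) (t x == Some y) = 0.
    by rewrite sum_Some_eq; case tx: (t x) => [y|] //; rewrite (negbTE (H y tx)).
  rewrite inE2 {1}/out (big_setD1 x) //= tX.
  have := oX t (X :\ x); have := oX p X; have := cardsD1 x X; rewrite xX /out; clear; lia.
by have := outT _ _ rt; have := outT _ _ rp; rewrite -innerT inE2 /=; clear; lia.
Qed.

(** * Orienting trees and unicyclic graphs *)

Lemma is_cycle_sub (V : finType) (F C : {set {set V}}) : is_cycle F C -> C \subset F.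
Proof.
case=> p [_ /andP[cp _] ->]; apply/subsetP=> e /imsetP[x xp ->].
exact: next_cycle cp xp.
Qed.

Lemma is_cycleS (V : finType) (F F' C : {set {set V}}) :
  F \subset F' -> is_cycle F C -> is_cycle F' C.
Proof.
move=> /subsetP FF' [p [sp /andP[cp up] ->]]; exists p; split=> //; rewrite /ucycle up andbT.
by apply: sub_cycle cp => x y; apply: FF'.
Qed.

Lemma is_cycle_connected (V : finType) (F C : {set {set V}}) : is_cycle F C ->
  exists x, cover C \subset connect (edge_rel F) x.
Proof.
case=> p [sp /andP[cp up] ->].
have [x xp] : exists x, x \in p by case: p sp {cp up} => [|x p] // _; exists x; rewrite mem_head.
have conn y : y \in p -> connect (edge_rel F) x y.
  rewrite -(fconnect_cycle (cycle_next up) xp) => /iter_findex <-.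
  elim: findex => //= n IH; apply: connect_trans IH _; apply: connect1.
  by apply: next_cycle cp _; elim: n => [|n IH] //=; rewrite mem_next.
exists x; apply/subsetP=> y /bigcupP[_ /imsetP[z zp ->]]; rewrite !inE => /orP[] /eqP->.
  exact: conn.
by apply: conn; rewrite mem_next.
Qed.

Lemma edge_rel_sym (V : finType) (F : {set {set V}}) : symmetric (edge_rel F).
Proof. by move=> x y; rewrite /edge_rel setUC. Qed.

Lemma edge_connect_sym (V : finType) (F : {set {set V}}) : connect_sym (edge_rel F).
Proof. exact: sym_connect_sym (@edge_rel_sym V F). Qed.

(** A simple path avoiding the edge has at least three vertices, and the edge closes it to a
    cycle. *)
Lemma acyclic_bridge (V : finType) (F : {set {set V}}) x y : (forall C, ~ is_cycle F C) ->
  x != y -> edge_rel F x y -> ~~ connect (edge_rel (F :\ [set x; y])) x y.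
Proof.
move=> acyc xy Fxy; apply/negP=> /connectP[q0 pq0 yE0].
case: (shortenP pq0) yE0 => q pq uq _ yE.
have pF : path (edge_rel F) x q by apply: sub_path pq => a b; rewrite /edge_rel !inE => /andP[].
apply: (acyc [set [set z; next (x :: q) z] | z in x :: q]); exists (x :: q); split=> //.
  case: q pq yE {uq pF} => [|a [|b q]] //= pq yE; first by rewrite yE eqxx in xy.
  by move: pq; rewrite /edge_rel yE !inE eqxx.
by rewrite /ucycle uq andbT /= rcons_path pF -yE edge_rel_sym.
Qed.

Lemma cycle_edge_redundant (V : finType) (F C : {set {set V}}) : is_cycle F C ->
  exists a b, [/\ a != b, [set a; b] \in C & connect (edge_rel (C :\ [set a; b])) a b].
Proof.
case=> p [sp /andP[cp up] EC].
have : cycle (edge_rel C) p.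
  apply: cycle_from_next => // x xp; rewrite /edge_rel EC; apply/imsetP; by exists x.
case: p sp up {cp EC} => [|a [|b [|c r]]] // _ up cC.
have [ab bC] : a != b /\ [set a; b] \in C.
  by move: up cC; rewrite /= !inE !negb_or -!andbA => /andP[-> _] /andP[].
exists a, b; split=> //; rewrite edge_connect_sym; apply/connectP; exists (c :: rcons r a).
  move: up cC; rewrite /= !inE !negb_or -!andbA => /and5P[_ ac ar bc /andP[br _]] /and3P[_ bcC pr].
  apply/andP; split.
    rewrite /edge_rel in_setD1 [_ \in C]bcC andbT; apply/eqP.
    by case/eq_set2P=> [[_ cb]|[_ ca]]; [rewrite cb eqxx in bc|rewrite ca eqxx in ac].
  apply: (@sub_in_path _ (predC1 b)) pr => [x y|].
    rewrite !inE => xb yb xyC; rewrite /edge_rel in_setD1 [_ \in C]xyC andbT.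
    by apply/eqP=> /eq_set2P[[_ yE]|[xE _]]; [rewrite yE eqxx in yb|rewrite xE eqxx in xb].
  rewrite /= eq_sym bc all_rcons /= ab; apply/allP=> z zr /=.
  by apply: contraNneq br => <-.
by rewrite /= last_rcons.
Qed.

(** [d x] is the distance from [x] to [rho x], and [par x] is the first step of a shortest path;
    [rho] being constant along edges, the rest of that path still ends at the right root. *)
Lemma parents (V : finType) (e : rel V) (rho : V -> V) :
  (forall x, connect e x (rho x)) -> (forall x y, e x y -> rho x = rho y) ->
  exists (par : V -> V) (d : V -> nat),
    forall x, x != rho x -> e x (par x) /\ d (par x) < d x.
Proof.
move=> conn inv.
have ex x : exists n, [exists q : n.-tuple V, path e x q && (last x q == rho x)].
  have /connectP[q pq qE] := conn x; exists (size q); apply/existsP; exists (in_tuple q).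
  by rewrite pq -qE eqxx.
pose d x := ex_minn (ex x).
suff /fin_all_exists[par parP] x : exists y, x != rho x -> e x y /\ d y < d x by exists par, d.
rewrite {2}/d; case: ex_minnP => n /existsP[q /andP[pq /eqP qE]] _.
case: n q pq qE => [|n] q pq qE; first by exists x; rewrite (tuple0 q) /= in qE; rewrite -qE eqxx.
case/tupleP: q pq qE => y q /= /andP[xy pq] qE; exists y => _; split=> //.
rewrite ltnS /d; case: ex_minnP => m _; apply; apply/existsP; exists q.
by rewrite pq qE (inv x y) ?eqxx.
Qed.

(* An edge followed by no parent arc could be deleted without disconnecting its
   ends, which both remain joined to the root. *)
Lemma forest_oriented (V : finType) (F : {set {set V}}) (rho : V -> V) :
  (forall x y, edge_rel F x y -> x != y) -> (forall C, ~ is_cycle F C) ->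
  (forall x, connect (edge_rel F) x (rho x)) -> (forall x y, edge_rel F x y -> rho x = rho y) ->
  exists s, [/\ forall x y, arcs s x y = edge_rel F x y, grounded s
              & forall x, (s x == None) = (x == rho x)].
Proof.
move=> lF aF conn inv; have [par [d parP]] := parents conn inv.
pose s x := if x == rho x then None else Some (par x).
have sP x y : s x = Some y -> edge_rel F x y /\ d y < d x.
  by rewrite /s; case: eqP => // /eqP/parP H [<-].
exists s; split; last by move=> x; rewrite /s; case: (x == rho x).
- move=> x y; have [Fxy|nFxy] := boolP (edge_rel F x y); last first.
    rewrite /arcs; case: eqP => [/sP[E _]|_]; first by rewrite E in nFxy.
    by case: eqP => [/sP[E _]|_] //; rewrite edge_rel_sym E in nFxy.
  rewrite /arcs; case: eqP => [/sP[_ lt]|nx]; case: eqP => [/sP[_ lt']|ny] //=.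
    by move: lt lt'; clear; lia.
  have xy := lF _ _ Fxy; case/negP: (acyclic_bridge aF xy Fxy).
  have toR n z : d z <= n -> connect (edge_rel (F :\ [set x; y])) z (rho z).
    elim: n z => [|n IH] z dz; have [<-//|zr] := eqVneq z (rho z); have [Fz lt] := parP z zr.
      by move: lt dz; clear; lia.
    have sz : s z = Some (par z) by rewrite /s (negbTE zr).
    rewrite (inv _ _ Fz); apply: connect_trans (IH (par z) _); last by move: lt dz; clear; lia.
    apply: connect1; rewrite /edge_rel in_setD1 [_ \in F]Fz andbT.
    apply/eqP=> /eq_set2P[[zx py]|[zy px]]; first by apply: nx; rewrite -zx sz py.
    by apply: ny; rewrite -zy sz px.
  apply: connect_trans (toR _ x (leqnn _)) _.
  by rewrite (inv _ _ Fxy) edge_connect_sym; apply: toR (leqnn _).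
- by apply: (@grounded_depth _ _ d) => x y /sP[].
Qed.


(* Deleting one edge [a z, b z] of the cycle of each component leaves a forest
   with the same components; root it at the [a z] and add the arcs from [a z]
   to [b z]. *)
Lemma unicyclic_oriented (V : finType) (F : {set {set V}}) :
  (forall x y, edge_rel F x y -> x != y) -> components_unicyclic F ->
  exists s, (forall x y, arcs s x y = edge_rel F x y) /\ rooted s None.
Proof.
move=> lF uF; pose e := edge_rel F; pose rt := root e.
have symF := edge_connect_sym F.
have rtE x y : connect e x y = (rt x == rt y) by rewrite /rt (root_connect symF).
pose good z (q : V * V) := exists C, [/\ is_cycle F C, cover C \subset connect e z,
    forall C', is_cycle F C' -> cover C' \subset connect e z -> C = C', q.1 != q.2 &
    [set q.1; q.2] \in C /\ connect (edge_rel (C :\ [set q.1; q.2])) q.1 q.2].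
have /fin_all_exists[c cP] : forall z, exists q, good z q.
  move=> z; have [C [[cC sC] uC]] := uF z.
  have [a [b [ab abC conn]]] := cycle_edge_redundant cC.
  by exists (a, b), C; split=> // C' cC' sC'; apply: uC.
(* Choosing through the representative [rt x] gives all vertices of a component the same edge. *)
pose a x := (c (rt x)).1; pose b x := (c (rt x)).2.
pose E0 := [set [set a x; b x] | x : V].
have cycC x : exists C, [/\ is_cycle F C, cover C \subset connect e x,
    forall C', is_cycle F C' -> cover C' \subset connect e x -> C = C', a x != b x &
    [set a x; b x] \in C /\ connect (edge_rel (C :\ [set a x; b x])) (a x) (b x)].
  have [C [cC sC uC ab abC]] := cP (rt x); exists C.
  have same : connect e (rt x) =i connect e x.
    by move=> y; rewrite !inE !rtE /rt root_root.
  split=> //; first by rewrite -(eq_subset_r same).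
  by move=> C' cC'; rewrite -(eq_subset_r same); apply: uC.
have in_E0 x : [set a x; b x] \in E0 by apply/imsetP; exists x.
have ab x : a x != b x by have [C []] := cycC x.
have rab x : rt (a x) = rt x /\ rt (b x) = rt x.
  have [C [_ /subsetP sC _ _ [abC _]]] := cycC x.
  have in_cov y : y \in [set a x; b x] -> rt y = rt x.
    move=> yab; have : y \in connect e x by apply: sC; apply/bigcupP; exists [set a x; b x].
    by rewrite inE rtE => /eqP.
  by rewrite !in_cov ?set21 ?set22.
have abF x : [set a x; b x] \in F.
  by have [C [/is_cycle_sub/subsetP sC _ _ _ [abC _]]] := cycC x; apply: sC.
pose F' := F :\: E0.
have F'F : F' \subset F by apply: subsetDl.
have conn' : connect e =2 connect (edge_rel F').
  move=> x0 y0; apply/idP/idP; apply: connect_sub => x y xy; last first.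
    by apply: connect1; apply: (subsetP F'F).
  have [xyE|xyE] := boolP ([set x; y] \in E0); last first.
    by apply: connect1; rewrite /edge_rel inE xyE.
  case/imsetP: xyE => z _ Ez.
  have [C [cC sC _ _ [abC conn]]] := cycC z.
  have sub : connect (edge_rel F') (a z) (b z).
    apply: connect_sub conn => u v; rewrite /edge_rel in_setD1 => /andP[uvn uvC].
    apply: connect1; rewrite /edge_rel inE (subsetP (is_cycle_sub cC) _ uvC) andbT.
    (* A deleted edge on this cycle was chosen for the same component, so it is the edge [a z],
       [b z] itself. *)
    apply: contra uvn => /imsetP[w _ Ew]; rewrite Ew.
    have : rt (a w) = rt z.
      apply/eqP; rewrite eq_sym -rtE; apply: (subsetP sC); apply/bigcupP.
      by exists [set u; v]; rewrite // Ew set21.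
    by rewrite (rab w).1 /a /b => ->.
  by case/eq_set2P: Ez => [[-> ->]|[-> ->]] //; rewrite edge_connect_sym.
(* A cycle of [F'] would be the unique cycle of its component in [F], but that one has lost an
   edge. *)
have acyc C : ~ is_cycle F' C.
  move=> cC; have cF := is_cycleS F'F cC; have [x sC] := is_cycle_connected cF.
  have [C' [_ _ uC' _ [abC _]]] := cycC x.
  move: abC; rewrite (uC' C cF sC) => /(subsetP (is_cycle_sub cC)).
  by rewrite inE in_E0.
have lF' x y : edge_rel F' x y -> x != y by move=> /(subsetP F'F); apply: lF.
have connA x : connect (edge_rel F') x (a x) by rewrite -conn' rtE (rab x).1.
have rtA x y : rt x = rt y -> a x = a y /\ b x = b y by rewrite /a /b => ->.
have invA x y : edge_rel F' x y -> a x = a y.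
  move=> /(subsetP F'F) xy; have : connect e x y by apply: connect1.
  by rewrite rtE => /eqP/rtA[].
have [s [sE _ sN]] := forest_oriented lF' acyc connA invA.
pose p x := if x == a x then Some (b x) else s x.
exists p; split; last by move=> x; rewrite /p; case: ifP => // xa; rewrite sN xa.
(* The added arcs alone; they occur where [s] has none, so the arcs of [p] are those of [s] and [h]
   together. *)
pose h x := if x == a x then Some (b x) else None.
have pE x y : (p x == Some y) = (s x == Some y) + (h x == Some y) :> nat.
  rewrite /p /h; have := sN x; case: ifP => _; last by rewrite addn0.
  by move/eqP->.
have hP x y : h x = Some y -> [set x; y] = [set a x; b x] /\ rt x = rt y.
  by rewrite /h; case: eqP => // xa [<-]; rewrite -xa (rab x).2.
have hE x y : arcs h x y = ([set x; y] \in E0).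
  have [/imsetP[z _ Ez]|nE] := boolP ([set x; y] \in E0); last first.
    rewrite /arcs; case: eqP => [/hP[Exy _]|_]; first by rewrite Exy in_E0 in nE.
    by case: eqP => [/hP[Exy _]|_] //; rewrite setUC Exy in_E0 in nE.
  have ha : h (a z) = Some (b z) by rewrite /h; have [-> ->] := rtA _ _ (rab z).1; rewrite eqxx.
  have hb : h (b z) = None.
    by rewrite /h; have [-> _] := rtA _ _ (rab z).2; rewrite eq_sym (negbTE (ab z)).
  by case/eq_set2P: Ez => [[-> ->]|[-> ->]]; rewrite /arcs ha hb eqxx.
move=> x y; rewrite /arcs !pE addnACA -/(arcs s x y) -/(arcs h x y) sE hE.
rewrite /edge_rel inE; case: (boolP ([set x; y] \in E0)) => [/imsetP[z _ ->]|_] /=.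
  by rewrite abF.
by rewrite addn0.
Qed.

Lemma tree_and_unicyclic_oriented (G : sgraph) : tree_and_unicyclic G -> oriented G.
Proof.
case=> T [P [TP dTP [/card_gt0P[r _] cT aT] uP]].
have loopless (F : {set {set G}}) : F \subset edges G -> forall x y, edge_rel F x y -> x != y.
  by move=> /subsetP FE x y /FE; rewrite in_edges; apply: adj_neq.
have TE : T \subset edges G by rewrite -TP subsetUl.
have PE : P \subset edges G by rewrite -TP subsetUr.
have [t [tE gt tN]] := forest_oriented (rho := fun _ => r) (loopless T TE) aT
  (fun x => cT x r) (fun _ _ _ => erefl).
have [p [pE pN]] := unicyclic_oriented (loopless P PE) uP.
exists t, p, r; split=> // [x y|x]; last by rewrite tN eq_sym.
rewrite tE pE /edge_rel -in_edges -TP inE.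
case: (boolP ([set x; y] \in T)) => //= xyT.
by rewrite (disjointFr dTP xyT).
Qed.

Theorem theorem1p4 (G : sgraph) :
  [<-> tight 1 G; derivable G; tree_and_unicyclic G].
Proof.
tfae; first exact: tight_derivable.
- by move/derivable_oriented; apply: oriented_tree_and_unicyclic.
- by move/tree_and_unicyclic_oriented; apply: oriented_tight.
Qed.
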